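(* Let $p\in\mathbb{C}[t]$ be a non-constant polynomial with $e^{p(0)}=1$, and let $f(z)=\int_{0}^{z}e^{p(t)}\,dt$. Then $f$ belongs to $\mathrm{elh}(\mathbb{C})\setminus\mathrm{Aut}(\mathbb{C})$, and there do not exist functions $L,g\in\mathrm{elh}(\mathbb{C})\setminus\mathrm{Aut}(\mathbb{C})$ with $L(\mathbb{C})=\mathbb{C}$ such that $f(z)=g(L(z))$ for all $z\in\mathbb{C}$.
   Context: $\mathrm{elh}(\mathbb{C})$ is the set of all entire functions $f:\mathbb{C}\to\mathbb{C}$ with $f'(z)\neq 0$ for all $z\in\mathbb{C}$ and $f'(0)=1$. $\mathrm{Aut}(\mathbb{C})=\{z+a : a\in\mathbb{C}\}\subseteq\mathrm{elh}(\mathbb{C})$. *)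

(* Defs.v *)
From Stdlib Require Import Reals List.
From Coquelicot Require Import Coquelicot.

Open Scope C_scope.

Definition Cexp (z : C) : C :=
  (exp (Re z) * cos (Im z), exp (Re z) * sin (Im z))%R.

(* Polynomials are lists of coefficients, constant term first; trailing zeros
   are allowed. *)
Definition Cpoly : Type := list C.

Definition Cpoly_eval (p : Cpoly) (z : C) : C :=
  fold_right (fun c v => c + z * v) 0 p.

Definition Cpoly_nonconstant (p : Cpoly) : Prop :=
  exists k : nat, (1 <= k)%nat /\ nth k p (RtoC 0) <> 0.

(* The integral of h along the straight segment from a to b; for entire h this
   is the path-independent integral from a to b. *)
Definition Cint (h : C -> C) (a b : C) : C :=
  RInt (V := C_R_CompleteNormedModule)
    (fun s : R => h (a + s * (b - a)) * (b - a)) 0 1.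

(* Differentiability is over the field C, not over R. *)
Definition entire (f : C -> C) : Prop :=
  forall z : C, @ex_derive C_AbsRing C_NormedModule f z.

(* [C_derive] is a total function, equal to the complex derivative wherever the
   latter exists (is_C_derive_unique), hence everywhere for entire f. *)
Definition elh (f : C -> C) : Prop :=
  entire f /\ (forall z : C, C_derive f z <> 0) /\ C_derive f 0 = 1.

Definition AutC (f : C -> C) : Prop :=
  exists a : C, forall z : C, f z = z + a.

(* Main.v *)
(** Suppose f = g o L, and put kap = g''/g', an entire function. The logarithmic
    derivative of f' = g'(L) L' = e^p reads
      kap(L(z)) L'(z) + L''(z) / L'(z) = p'(z).
    If L has polynomial growth, then L' = e^h with Re h logarithmically bounded, so h is
    constant and L is a translation. Otherwise a comparison argument in the style of
    Macintyre and Wiman-Valiron gives points z0, with |L(z0)| large compared to any fixed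
    multiple of |z0|^d, near which L(z0 e^(x/K)) / L(z0) is close to e^x. Hence L covers the
    circle |w| = |L(z0)| near z0 with controlled L' and L'', and the equation makes kap small
    on that circle. By the mean value property kap(0) = 0; applying this to L - w0 and
    kap(. + w0) gives kap = 0, so g'' = 0 and g is a translation.

    The complex analysis needed rests on Goursat's theorem for rectangles, used in the
    coordinate zeta of w = z + e^zeta, in which circles become vertical segments. *)

Require Import Defs.
From Stdlib Require Import Reals Lra Lia List Classical ClassicalEpsilon.
From Coquelicot Require Import Coquelicot.

Open Scope C_scope.

(** * Complex derivatives and the exponential *)

(** A large value of [L] alone would not do: the mean value property of [kap] needs a bound on a
    full circle, so [L] must take every value of modulus |L(z0)| in a region where z p'(z) is still
    O(|z0|^d). The model e^x does this once the window in x has height above 2 pi, and its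
    derivatives are as large as its value. This fixes the radii: an upper bound for |x| <= 12 gives
    closeness to e^x for |x| <= 6, hence all values e^(i phi) with |phi| <= 4 at points |x| <= 5,
    with one unit of room for a Cauchy estimate of the second derivative. Classical Wiman-Valiron
    theory reads such points off the maximal term of the power series. Here no power series occurs:
    z0 almost maximises a penalised modulus of [L], which yields only an upper bound for |L| near
    z0. The upper bound suffices because an entire function with value 1 at 0 and real part at most
    1 + eps on a disc is nearly 1 on the disc of half the radius. *)

Definition is_cderive (f : C -> C) (z l : C) : Prop :=
  @is_derive C_AbsRing C_NormedModule f z l.

Lemma is_cderiveP (f : C -> C) (z l : C) :
  is_cderive f z l <->
  forall eps : R, (0 < eps)%R -> exists d : R, (0 < d)%R /\
    forall w, (Cmod (w - z) < d)%R ->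
      (Cmod (f w - f z - l * (w - z)) <= eps * Cmod (w - z))%R.
Proof.
  split.
  - intros [_ H] eps He.
    destruct (H z (fun P HP => HP) (mkposreal eps He)) as [d Hd].
    exists d; split; [apply cond_pos|].
    intros w Hw.
    replace (l * (w - z)) with ((w - z) * l) by ring.
    exact (Hd w Hw).
  - intros H; split; [apply is_linear_scal_l|].
    intros x Hx eps.
    rewrite <- (@is_filter_lim_locally_unique C_AbsRing (AbsRing_NormedModule C_AbsRing) z x Hx).
    destruct (H eps (cond_pos eps)) as [d [Hd0 Hd]].
    exists (mkposreal d Hd0). intros w Hw.
    generalize (Hd w Hw).
    replace (l * (w - z)) with ((w - z) * l) by ring.
    exact (fun h => h).
Qed.

(* Coquelicot puts two (equivalent, not convertible) uniform structures on C; the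
   product and composition rules are stated for the one induced by the modulus. *)
Lemma is_cderive_AbsRing (f : C -> C) (z l : C) :
  is_cderive f z l <-> @is_derive C_AbsRing (AbsRing_NormedModule C_AbsRing) f z l.
Proof.
  split.
  - intros H; split; [apply is_linear_scal_l|].
    intros x Hx eps.
    rewrite <- (@is_filter_lim_locally_unique C_AbsRing (AbsRing_NormedModule C_AbsRing) z x Hx).
    destruct (proj1 (is_cderiveP f z l) H eps (cond_pos eps)) as [d [Hd0 Hd]].
    exists (mkposreal d Hd0). intros w Hw.
    generalize (Hd w Hw).
    replace (l * (w - z)) with ((w - z) * l) by ring.
    exact (fun h => h).
  - intros [_ H]. apply is_cderiveP. intros eps He.
    destruct (H z (fun P HP => HP) (mkposreal eps He)) as [d Hd].
    exists d; split; [apply cond_pos|].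
    intros w Hw.
    replace (l * (w - z)) with ((w - z) * l) by ring.
    exact (Hd w Hw).
Qed.

Definition is_vderive (g : R -> C) (t : R) (l : C) : Prop :=
  @is_derive R_AbsRing C_R_NormedModule g t l.

Lemma is_vderiveP (g : R -> C) (t : R) (l : C) :
  is_vderive g t l <->
  forall eps : R, (0 < eps)%R -> exists d : R, (0 < d)%R /\
    forall u, (Rabs (u - t) < d)%R ->
      (Cmod (g u - g t - RtoC (u - t) * l) <= eps * Rabs (u - t))%R.
Proof.
  assert (E : forall u, scal (V := C_R_NormedModule) (u - t)%R l = RtoC (u - t) * l).
  { intros u. unfold scal; simpl. unfold prod_scal, scal; simpl. unfold mult; simpl.
    destruct l as [l1 l2]; unfold Cmult, RtoC; simpl. f_equal; ring. }
  split.
  - intros [_ H] eps He.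
    destruct (H t (fun P HP => HP) (mkposreal eps He)) as [d Hd].
    exists d; split; [apply cond_pos|].
    intros u Hu. rewrite Cmod_norm, <- E. exact (Hd u Hu).
  - intros H; split; [apply is_linear_scal_l|].
    intros x Hx eps.
    rewrite <- (is_filter_lim_locally_unique t x Hx).
    destruct (H eps (cond_pos eps)) as [d [Hd0 Hd]].
    exists (mkposreal d Hd0). intros w Hw.
    generalize (Hd w Hw). rewrite <- E, Cmod_norm. exact (fun h => h).
Qed.

Lemma is_cderive_ext (f g : C -> C) z l :
  (forall w, f w = g w) -> is_cderive f z l -> is_cderive g z l.
Proof. intros H; apply is_derive_ext; exact H. Qed.

Lemma is_cderive_eq f z l l' : is_cderive f z l -> l = l' -> is_cderive f z l'.
Proof. intros H <-; exact H. Qed.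

Lemma is_cderive_const (a z : C) : is_cderive (fun _ => a) z 0.
Proof. exact (@is_derive_const C_AbsRing C_NormedModule a z). Qed.

Lemma is_cderive_id (z : C) : is_cderive (fun w => w) z 1.
Proof. apply is_cderive_AbsRing. exact (@is_derive_id C_AbsRing z). Qed.

Lemma is_cderive_plus f g z a b :
  is_cderive f z a -> is_cderive g z b -> is_cderive (fun w => f w + g w) z (a + b).
Proof. exact (@is_derive_plus C_AbsRing C_NormedModule f g z a b). Qed.

Lemma is_cderive_opp f z a : is_cderive f z a -> is_cderive (fun w => - f w) z (- a).
Proof. exact (@is_derive_opp C_AbsRing C_NormedModule f z a). Qed.

Lemma is_cderive_minus f g z a b :
  is_cderive f z a -> is_cderive g z b -> is_cderive (fun w => f w - g w) z (a - b).
Proof. exact (@is_derive_minus C_AbsRing C_NormedModule f g z a b). Qed.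

Lemma is_cderive_comp f g z a b :
  is_cderive f (g z) a -> is_cderive g z b -> is_cderive (fun w => f (g w)) z (a * b).
Proof.
  intros Hf Hg. replace (a * b) with (b * a) by ring.
  apply is_cderive_AbsRing in Hg.
  exact (@is_derive_comp C_AbsRing C_NormedModule f g z a b Hf Hg).
Qed.

Lemma is_cderive_mult f g z a b :
  is_cderive f z a -> is_cderive g z b ->
  is_cderive (fun w => f w * g w) z (a * g z + f z * b).
Proof.
  rewrite !is_cderive_AbsRing. intros Hf Hg.
  exact (@is_derive_mult C_AbsRing f g z a b Hf Hg Cmult_comm).
Qed.

Lemma is_cderive_continuous f z l : is_cderive f z l ->
  forall eps : R, (0 < eps)%R -> exists d : R, (0 < d)%R /\
    forall w, (Cmod (w - z) < d)%R -> (Cmod (f w - f z) <= eps)%R.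
Proof.
  intros H eps He.
  apply is_cderiveP with (eps := 1%R) in H as [d [Hd H]]; [|lra].
  assert (Hl := Cmod_ge_0 l).
  exists (Rmin d (eps / (Cmod l + 1))).
  split; [apply Rmin_pos; auto; apply Rdiv_lt_0_compat; lra|].
  intros w Hw.
  assert (H1 := H w (Rlt_le_trans _ _ _ Hw (Rmin_l _ _))).
  assert (H2 := Rlt_le_trans _ _ _ Hw (Rmin_r _ _)).
  replace (f w - f z) with ((f w - f z - l * (w - z)) + l * (w - z)) by ring.
  eapply Rle_trans; [apply Cmod_triangle|]. rewrite Cmod_mult.
  assert (H3 : ((Cmod l + 1) * Cmod (w - z) <= eps)%R).
  { apply Rmult_le_reg_l with (/ (Cmod l + 1))%R; [apply Rinv_0_lt_compat; lra|].
    rewrite <- Rmult_assoc, Rinv_l, Rmult_1_l by lra. unfold Rdiv in H2. lra. }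
  lra.
Qed.

Lemma is_cderive_Cinv (z : C) : z <> 0 -> is_cderive Cinv z (- / (z * z)).
Proof.
  intros Hz. apply is_cderiveP. intros eps He.
  assert (Hm : (0 < Cmod z)%R) by (apply Cmod_gt_0; exact Hz).
  set (m := Cmod z) in *.
  exists (Rmin (m / 2) (eps * m ^ 3 / 2)). split.
  { apply Rmin_pos; [lra|]. apply Rdiv_lt_0_compat; [|lra].
    apply Rmult_lt_0_compat; auto. apply pow_lt; auto. }
  intros w Hw.
  assert (H1 := Rlt_le_trans _ _ _ Hw (Rmin_l _ _)).
  assert (H2 := Rlt_le_trans _ _ _ Hw (Rmin_r _ _)).
  assert (Hwm : (m / 2 <= Cmod w)%R).
  { assert (T := Cmod_triangle w (- (w - z))).
    rewrite Cmod_opp in T. replace (w + - (w - z)) with z in T by ring.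
    fold m in T. lra. }
  assert (Hw0 : w <> 0).
  { intros ->. rewrite Cmod_0 in Hwm. lra. }
  replace (/ w - / z - - / (z * z) * (w - z)) with ((w - z) * (w - z) / (w * (z * z)))
    by (field; auto).
  assert (Hne : w * (z * z) <> 0) by (repeat apply Cmult_neq_0; auto).
  rewrite Cmod_div, !Cmod_mult by auto. fold m.
  set (d := Cmod (w - z)) in *. assert (Hd := Cmod_ge_0 (w - z)). fold d in Hd.
  assert (Hp : (0 < Cmod w * (m * m))%R) by (repeat apply Rmult_lt_0_compat; lra).
  apply Rmult_le_reg_r with (Cmod w * (m * m))%R; [exact Hp|].
  unfold Rdiv. rewrite Rmult_assoc, Rinv_l by lra. rewrite Rmult_1_r.
  assert (H3 : (eps * m ^ 3 / 2 <= eps * (Cmod w * (m * m)))%R).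
  { replace (eps * m ^ 3 / 2)%R with (eps * (m / 2 * (m * m)))%R by field.
    apply Rmult_le_compat_l; [lra|]. apply Rmult_le_compat_r; [nra|exact Hwm]. }
  replace (eps * d * (Cmod w * (m * m)))%R with (eps * (Cmod w * (m * m)) * d)%R by ring.
  apply Rmult_le_compat_r; [exact Hd|]. lra.
Qed.

Lemma is_cderive_inv f z l :
  is_cderive f z l -> f z <> 0 -> is_cderive (fun w => / f w) z (- l / (f z * f z)).
Proof.
  intros Hf Hz.
  eapply is_cderive_eq; [apply (is_cderive_comp Cinv f); [apply is_cderive_Cinv; auto|exact Hf]|].
  field; auto.
Qed.

Lemma is_cderive_div f g z a b :
  is_cderive f z a -> is_cderive g z b -> g z <> 0 ->
  is_cderive (fun w => f w / g w) z ((a * g z - f z * b) / (g z * g z)).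
Proof.
  intros Hf Hg Hz.
  eapply is_cderive_eq.
  { exact (is_cderive_mult _ _ z _ _ Hf (is_cderive_inv g z b Hg Hz)). }
  cbv beta.
  field; auto.
Qed.

Lemma is_cderive_affine a b z : is_cderive (fun w => a + b * w) z b.
Proof.
  eapply is_cderive_eq.
  - apply is_cderive_plus; [apply is_cderive_const|].
    apply is_cderive_mult; [apply is_cderive_const|apply is_cderive_id].
  - cbv beta. ring.
Qed.

Lemma Cexp_0 : Cexp 0 = 1.
Proof. unfold Cexp; simpl. rewrite exp_0, cos_0, sin_0. unfold RtoC. f_equal; ring. Qed.

Lemma Cexp_plus a b : Cexp (a + b) = Cexp a * Cexp b.
Proof.
  unfold Cexp, Cmult; destruct a as [a1 a2], b as [b1 b2]; simpl.
  rewrite exp_plus, cos_plus, sin_plus. f_equal; ring.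
Qed.

Lemma Cmod_Cexp z : Cmod (Cexp z) = exp (Re z).
Proof.
  unfold Cexp, Cmod; simpl.
  replace (exp (Re z) * cos (Im z) * (exp (Re z) * cos (Im z) * 1) +
   exp (Re z) * sin (Im z) * (exp (Re z) * sin (Im z) * 1))%R
   with ((exp (Re z))² * ((sin (Im z))² + (cos (Im z))²))%R by (unfold Rsqr; ring).
  rewrite sin2_cos2, Rmult_1_r. apply sqrt_Rsqr. left; apply exp_pos.
Qed.

Lemma Cexp_neq_0 z : Cexp z <> 0.
Proof. apply Cmod_gt_0. rewrite Cmod_Cexp. apply exp_pos. Qed.

Lemma Cmod_le_Re_Im (z : C) : (Cmod z <= Rabs (Re z) + Rabs (Im z))%R.
Proof.
  destruct z as [x y].
  replace (x, y) with (RtoC x + Ci * RtoC y).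
  - eapply Rle_trans; [apply Cmod_triangle|].
    rewrite Cmod_mult, Cmod_Ci, !Cmod_R. simpl.
    rewrite ?Rmult_0_l, ?Rmult_1_l, ?Rmult_0_r.
    right. f_equal; f_equal; ring.
  - unfold Cplus, Cmult, RtoC, Ci; simpl. f_equal; ring.
Qed.

Lemma im_le_Cmod (z : C) : (Rabs (Im z) <= Cmod z)%R.
Proof. eapply Rle_trans; [apply Rmax_r|apply (Rmax_Cmod z)]. Qed.

(** The real difference quotients of [exp], [cos] and [sin] give the derivative at 0; the functional
    equation transports it to any [z]. *)
Lemma is_cderive_Cexp (z : C) : is_cderive Cexp z (Cexp z).
Proof.
  assert (H0 : is_cderive Cexp 0 1).
  { apply is_cderiveP. intros eps He.
    (* Real and imaginary part of the error split into three terms each, and each of the six gets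
       eps / 6. *)
    pose (k := Rmin (eps / 6) 1). assert (Hk : (0 < k)%R) by (apply Rmin_pos; lra).
    destruct (derivable_pt_lim_exp 0 k Hk) as [d1 H1].
    destruct (derivable_pt_lim_cos 0 k Hk) as [d2 H2].
    destruct (derivable_pt_lim_sin 0 k Hk) as [d3 H3].
    rewrite exp_0 in H1. rewrite cos_0, sin_0 in H2. rewrite sin_0, cos_0 in H3.
    assert (L : forall (F : R -> R) (c a : R) (d : posreal),
      (forall h, h <> 0%R -> (Rabs h < d)%R -> (Rabs ((F (0 + h) - c) / h - a) < k)%R) ->
      F 0%R = c ->
      forall h, (Rabs h < d)%R -> (Rabs (F h - c - a * h) <= k * Rabs h)%R).
    { intros F c a d HF Fc h Hh. destruct (Req_dec h 0) as [->|Hh0].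
      - rewrite Fc. replace (c - c - a * 0)%R with 0%R by ring. rewrite Rabs_R0. lra.
      - specialize (HF h Hh0 Hh). rewrite Rplus_0_l in HF.
        replace (F h - c - a * h)%R with (((F h - c) / h - a) * h)%R by (field; auto).
        rewrite Rabs_mult. apply Rmult_le_compat_r; [apply Rabs_pos|lra]. }
    assert (K1 := L exp 1%R 1%R d1 H1 exp_0).
    assert (K2 := L cos 1%R (-0)%R d2 H2 cos_0).
    assert (K3 := L sin 0%R 1%R d3 H3 sin_0).
    exists (Rmin (Rmin d1 d2) (Rmin d3 (Rmin 1 (eps / 12)))). split.
    { repeat apply Rmin_pos; try apply cond_pos; lra. }
    intros w Hw. replace (w - 0) with w in * by ring.
    assert (W1 : (Cmod w < d1)%R).
    { eapply Rlt_le_trans; [exact Hw|]. eapply Rle_trans; [apply Rmin_l|apply Rmin_l]. }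
    assert (W2 : (Cmod w < d2)%R).
    { eapply Rlt_le_trans; [exact Hw|]. eapply Rle_trans; [apply Rmin_l|apply Rmin_r]. }
    assert (W3 : (Cmod w < d3)%R).
    { eapply Rlt_le_trans; [exact Hw|]. eapply Rle_trans; [apply Rmin_r|apply Rmin_l]. }
    assert (W4 : (Cmod w < Rmin 1 (eps / 12))%R).
    { eapply Rlt_le_trans; [exact Hw|]. eapply Rle_trans; [apply Rmin_r|apply Rmin_r]. }
    assert (W5 := Rlt_le_trans _ _ _ W4 (Rmin_l _ _)).
    assert (W6 := Rlt_le_trans _ _ _ W4 (Rmin_r _ _)).
    assert (Rx := re_le_Cmod w). assert (Iy := im_le_Cmod w).
    destruct w as [x y]. set (m := Cmod (x, y)) in *. unfold Re, Im in Rx, Iy; simpl in Rx, Iy.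
    specialize (K1 x ltac:(lra)). specialize (K2 y ltac:(lra)). specialize (K3 y ltac:(lra)).
    rewrite Cexp_0. eapply Rle_trans; [apply Cmod_le_Re_Im|].
    unfold Cexp; simpl.
    set (E := exp x) in *. set (c := cos y) in *. set (s := sin y) in *.
    assert (Ax := Rabs_pos x). assert (Ay := Rabs_pos y).
    assert (Bs : (Rabs s <= 1)%R).
    { apply Rabs_le. unfold s. destruct (SIN_bound y); lra. }
    assert (Bc : (Rabs c <= 1)%R).
    { apply Rabs_le. unfold c. destruct (COS_bound y); lra. }
    assert (k1 : (k <= eps / 6)%R) by apply Rmin_l.
    assert (k2 : (k <= 1)%R) by apply Rmin_r.
    assert (M0 := Cmod_ge_0 (x, y)). fold m in M0.
    assert (P1 : (Rabs (E - 1 - 1 * x) <= eps / 6 * m)%R) by nra.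
    assert (P2 : (Rabs (c - 1) <= eps / 6 * m)%R).
    { replace (c - 1)%R with (c - 1 - -0 * y)%R by ring. nra. }
    assert (P3 : (Rabs (s - y) <= eps / 6 * m)%R).
    { replace (s - y)%R with (s - 0 - 1 * y)%R by ring. nra. }
    assert (P4 : (Rabs (x * (c - 1)) <= eps / 6 * m)%R).
    { rewrite Rabs_mult. assert (X := Rabs_pos (c - 1)). nra. }
    assert (P5 : (Rabs ((E - 1 - 1 * x) * c) <= eps / 6 * m)%R).
    { rewrite Rabs_mult. assert (X := Rabs_pos (E - 1 - 1 * x)). nra. }
    assert (P6 : (Rabs ((E - 1 - 1 * x) * s) <= eps / 6 * m)%R).
    { rewrite Rabs_mult. assert (X := Rabs_pos (E - 1 - 1 * x)). nra. }
    assert (P7 : (Rabs (x * s) <= eps / 6 * m)%R).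
    { assert (Rabs s <= 2 * m)%R.
      { replace s with ((s - 0 - 1 * y) + y)%R by ring.
        eapply Rle_trans; [apply Rabs_triang|]. nra. }
      rewrite Rabs_mult. assert (X := Rabs_pos s). nra. }
    replace (E * c + - (1) + - (1 * x - 0 * y))%R with
      ((E - 1 - 1 * x) * c + x * (c - 1) + (c - 1))%R by ring.
    replace (E * s + - 0 + - (1 * y + 0 * x))%R with
      ((E - 1 - 1 * x) * s + x * s + (s - y))%R by ring.
    assert (T1 := Rabs_triang ((E - 1 - 1 * x) * c + x * (c - 1)) (c - 1)).
    assert (T2 := Rabs_triang ((E - 1 - 1 * x) * c) (x * (c - 1))).
    assert (T3 := Rabs_triang ((E - 1 - 1 * x) * s + x * s) (s - y)).
    assert (T4 := Rabs_triang ((E - 1 - 1 * x) * s) (x * s)).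
    lra. }
  apply is_cderive_ext with (fun w => Cexp z * Cexp (- z + 1 * w)).
  { intros w. rewrite <- Cexp_plus. f_equal. ring. }
  eapply is_cderive_eq.
  - apply is_cderive_mult; [apply is_cderive_const|].
    apply (is_cderive_comp Cexp); [|apply is_cderive_affine].
    replace (- z + 1 * z) with (RtoC 0) by ring. exact H0.
  - cbv beta. ring.
Qed.

(** * Integrals of curves *)

Definition vcont (g : R -> C) (t : R) : Prop :=
  @continuous R_UniformSpace C_UniformSpace g t.

Lemma vcontP (g : R -> C) (t : R) :
  vcont g t <->
  forall eps : R, (0 < eps)%R -> exists d : R, (0 < d)%R /\
    forall u, (Rabs (u - t) < d)%R -> (Cmod (g u - g t) <= eps)%R.
Proof.
  split.
  - intros H eps He.
    assert (He2 : (0 < eps / 2)%R) by lra.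
    apply (proj1 (filterlim_locally _ _)) with (eps := mkposreal _ He2) in H.
    destruct H as [d Hd]. exists d; split; [apply cond_pos|].
    intros u Hu. destruct (Hd u Hu) as [H1 H2].
    eapply Rle_trans; [apply Cmod_le_Re_Im|].
    apply Rlt_le in H1, H2. change (Rabs (fst (g u) - fst (g t)) <= eps / 2)%R in H1.
    change (Rabs (snd (g u) - snd (g t)) <= eps / 2)%R in H2.
    change (Rabs (fst (g u) - fst (g t)) + Rabs (snd (g u) - snd (g t)) <= eps)%R. lra.
  - intros H. apply filterlim_locally. intros eps.
    destruct (H (eps / 2)%R) as [d [Hd0 Hd]]; [assert (X := cond_pos eps); lra|].
    exists (mkposreal d Hd0). intros u Hu. specialize (Hd u Hu).
    assert (X := cond_pos eps).
    split.
    + apply Rle_lt_trans with (Cmod (g u - g t)); [apply (re_le_Cmod (g u - g t))|lra].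
    + apply Rle_lt_trans with (Cmod (g u - g t)); [apply (im_le_Cmod (g u - g t))|lra].
Qed.

Lemma vcont_ext g h t : (forall u, g u = h u) -> vcont g t -> vcont h t.
Proof. intros H; apply continuous_ext; exact H. Qed.

Lemma vcont_plus g h t : vcont g t -> vcont h t -> vcont (fun u => g u + h u) t.
Proof. exact (@continuous_plus R_UniformSpace R_AbsRing C_R_NormedModule g h t). Qed.

Lemma vcont_const c t : vcont (fun _ => c) t.
Proof. exact (@continuous_const R_UniformSpace C_UniformSpace c t). Qed.

Lemma vcont_comp (f : C -> C) (g : R -> C) t l :
  is_cderive f (g t) l -> vcont g t -> vcont (fun u => f (g u)) t.
Proof.
  intros Hf Hg. apply vcontP. intros eps He.
  destruct (is_cderive_continuous _ _ _ Hf eps He) as [d [Hd0 Hd]].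
  destruct (proj1 (vcontP _ _) Hg (d / 2)%R ltac:(lra)) as [d' [Hd0' Hd']].
  exists d'; split; auto. intros u Hu. apply Hd. specialize (Hd' u Hu). lra.
Qed.

Lemma vcont_scal c g t : vcont g t -> vcont (fun u => c * g u) t.
Proof.
  intros H. apply (vcont_comp (fun w => c * w) g t c); [|exact H].
  apply is_cderive_ext with (fun w => 0 + c * w); [intros; ring|apply is_cderive_affine].
Qed.

Lemma vcont_RtoC t : vcont RtoC t.
Proof.
  apply vcontP. intros eps He. exists eps; split; auto. intros u Hu.
  rewrite <- RtoC_minus, Cmod_R. lra.
Qed.

Lemma vcont_affine p q t : vcont (fun u => p + RtoC u * q) t.
Proof.
  apply vcont_plus; [apply vcont_const|].
  apply vcont_ext with (fun u => q * RtoC u); [intros; ring|].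
  apply vcont_scal, vcont_RtoC.
Qed.

Lemma vcont_mult g h t : vcont g t -> vcont h t -> vcont (fun u => g u * h u) t.
Proof.
  intros Hg Hh. apply vcontP. intros eps He.
  set (A := (Cmod (g t) + Cmod (h t) + 1)%R).
  assert (G := Cmod_ge_0 (g t)). assert (H := Cmod_ge_0 (h t)).
  assert (Hk : (0 < Rmin 1 (eps / A))%R).
  { apply Rmin_pos; [lra|]. apply Rdiv_lt_0_compat; unfold A; lra. }
  set (k := Rmin 1 (eps / A)) in *.
  assert (K1 : (k <= 1)%R) by apply Rmin_l.
  assert (K2 : (k * A <= eps)%R).
  { apply Rle_trans with (eps / A * A)%R.
    - apply Rmult_le_compat_r; [unfold A; lra|apply Rmin_r].
    - right; field; unfold A; lra. }
  destruct (proj1 (vcontP _ _) Hg k Hk) as [d1 [D1 E1]].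
  destruct (proj1 (vcontP _ _) Hh k Hk) as [d2 [D2 E2]].
  exists (Rmin d1 d2). split; [apply Rmin_pos; auto|]. intros u Hu.
  specialize (E1 u (Rlt_le_trans _ _ _ Hu (Rmin_l _ _))).
  specialize (E2 u (Rlt_le_trans _ _ _ Hu (Rmin_r _ _))).
  replace (g u * h u - g t * h t) with
    ((g u - g t) * (h u - h t) + ((g u - g t) * h t + g t * (h u - h t))) by ring.
  eapply Rle_trans; [apply Cmod_triangle|].
  eapply Rle_trans; [apply Rplus_le_compat_l, Cmod_triangle|].
  rewrite !Cmod_mult.
  assert (X := Cmod_ge_0 (g u - g t)). assert (Y := Cmod_ge_0 (h u - h t)).
  unfold A in K2. nra.
Qed.

Lemma vcont_conj g t : vcont g t -> vcont (fun u => Cconj (g u)) t.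
Proof.
  intros H. apply vcontP. intros eps He.
  destruct (proj1 (vcontP _ _) H eps He) as [d [D E]].
  exists d; split; auto. intros u Hu.
  rewrite <- Cminus_conj, Cmod_conj. auto.
Qed.

Lemma vcont_minus g h t : vcont g t -> vcont h t -> vcont (fun u => g u - h u) t.
Proof.
  intros Hg Hh. apply vcont_ext with (fun u => g u + - (1) * h u); [intros; ring|].
  apply vcont_plus; [exact Hg|apply vcont_scal, Hh].
Qed.

Definition CI (g : R -> C) (a b : R) : C :=
  RInt (V := C_R_CompleteNormedModule) g a b.

Definition vcont_on (g : R -> C) (a b : R) : Prop :=
  forall t, (a <= t <= b)%R -> vcont g t.

Lemma CI_correct g a b : (a <= b)%R -> vcont_on g a b ->
  @is_RInt C_R_NormedModule g a b (CI g a b).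
Proof.
  intros Hab H. apply (RInt_correct (V := C_R_CompleteNormedModule)).
  apply (ex_RInt_continuous (V := C_R_CompleteNormedModule)).
  intros t. rewrite Rmin_left, Rmax_right by exact Hab. apply H.
Qed.

Lemma CI_unique g a b l : @is_RInt C_R_NormedModule g a b l -> CI g a b = l.
Proof. exact (is_RInt_unique (V := C_R_CompleteNormedModule) g a b l). Qed.

Lemma CI_ext g h a b : (a <= b)%R -> (forall t, (a <= t <= b)%R -> g t = h t) ->
  CI g a b = CI h a b.
Proof.
  intros Hab H. apply (RInt_ext (V := C_R_CompleteNormedModule)).
  intros t. rewrite Rmin_left, Rmax_right by exact Hab. intros Ht. apply H. lra.
Qed.

Lemma CI_plus g h a b : (a <= b)%R -> vcont_on g a b -> vcont_on h a b ->
  CI (fun t => g t + h t) a b = CI g a b + CI h a b.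
Proof.
  intros Hab Hg Hh. apply CI_unique.
  exact (is_RInt_plus (V := C_R_NormedModule) g h a b _ _
    (CI_correct _ _ _ Hab Hg) (CI_correct _ _ _ Hab Hh)).
Qed.

Lemma CI_Re g a b : (a <= b)%R -> vcont_on g a b ->
  is_RInt (fun t => Re (g t)) a b (Re (CI g a b)).
Proof.
  intros Hab Hg.
  exact (is_RInt_fct_extend_fst (U := R_NormedModule) (V := R_NormedModule) g a b _ (CI_correct g a b Hab Hg)).
Qed.

Lemma CI_Im g a b : (a <= b)%R -> vcont_on g a b ->
  is_RInt (fun t => Im (g t)) a b (Im (CI g a b)).
Proof.
  intros Hab Hg.
  exact (is_RInt_fct_extend_snd (U := R_NormedModule) (V := R_NormedModule) g a b _ (CI_correct g a b Hab Hg)).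
Qed.

Lemma CI_pair g a b x y :
  is_RInt (fun t => Re (g t)) a b x -> is_RInt (fun t => Im (g t)) a b y ->
  CI g a b = (x, y).
Proof.
  intros Hx Hy. apply CI_unique.
  exact (is_RInt_fct_extend_pair (U := R_NormedModule) (V := R_NormedModule) g a b x y Hx Hy).
Qed.

(** [CI] is an integral in a real normed module, where only real factors come out directly; a
    complex factor is passed through real and imaginary parts. *)
Lemma CI_scal c g a b : (a <= b)%R -> vcont_on g a b ->
  CI (fun t => c * g t) a b = c * CI g a b.
Proof.
  intros Hab Hg. assert (HR := CI_Re g a b Hab Hg). assert (HI := CI_Im g a b Hab Hg).
  rewrite (CI_pair _ a b (Re c * Re (CI g a b) - Im c * Im (CI g a b))%R
                         (Re c * Im (CI g a b) + Im c * Re (CI g a b))%R).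
  - reflexivity.
  - apply (is_RInt_minus (V := R_NormedModule));
      apply (is_RInt_scal (V := R_NormedModule)); assumption.
  - apply (is_RInt_plus (V := R_NormedModule));
      apply (is_RInt_scal (V := R_NormedModule)); assumption.
Qed.

Lemma CI_conj g a b : (a <= b)%R -> vcont_on g a b ->
  CI (fun t => Cconj (g t)) a b = Cconj (CI g a b).
Proof.
  intros Hab Hg. apply CI_pair.
  - exact (CI_Re g a b Hab Hg).
  - exact (is_RInt_opp (V := R_NormedModule) _ a b _ (CI_Im g a b Hab Hg)).
Qed.

Lemma CI_minus g h a b : (a <= b)%R -> vcont_on g a b -> vcont_on h a b ->
  CI (fun t => g t - h t) a b = CI g a b - CI h a b.
Proof.
  intros Hab Hg Hh. apply CI_unique.
  exact (is_RInt_minus (V := C_R_NormedModule) g h a b _ _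
    (CI_correct _ _ _ Hab Hg) (CI_correct _ _ _ Hab Hh)).
Qed.

Lemma CI_Chasles g a b c : (a <= b)%R -> (b <= c)%R -> vcont_on g a c ->
  CI g a c = CI g a b + CI g b c.
Proof.
  intros Hab Hbc Hg. apply CI_unique.
  apply (is_RInt_Chasles (V := C_R_NormedModule) g a b c); apply CI_correct; auto;
    intros t Ht; apply Hg; lra.
Qed.

Lemma CI_const c a b : CI (fun _ => c) a b = RtoC (b - a) * c.
Proof.
  apply CI_pair; simpl.
  - replace ((b - a) * fst c - 0 * snd c)%R with (scal (b - a) (Re c))%R
      by (unfold scal; simpl; unfold mult, Re; simpl; ring).
    apply (is_RInt_const (V := R_NormedModule)).
  - replace ((b - a) * snd c + 0 * fst c)%R with (scal (b - a) (Im c))%R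
      by (unfold scal; simpl; unfold mult, Im; simpl; ring).
    apply (is_RInt_const (V := R_NormedModule)).
Qed.

Lemma CI_norm_le g (h : R -> R) a b l : (a <= b)%R -> vcont_on g a b ->
  (forall t, (a <= t <= b)%R -> (Cmod (g t) <= h t)%R) -> is_RInt h a b l ->
  (Cmod (CI g a b) <= l)%R.
Proof.
  intros Hab Hg Hle Hh. rewrite Cmod_norm.
  apply (norm_RInt_le (V := C_R_NormedModule) g h a b _ l Hab); auto.
  - intros t Ht. rewrite <- Cmod_norm. auto.
  - apply CI_correct; auto.
Qed.

Lemma CI_bound g a b M : (a <= b)%R -> vcont_on g a b ->
  (forall t, (a <= t <= b)%R -> (Cmod (g t) <= M)%R) ->
  (Cmod (CI g a b) <= M * (b - a))%R.
Proof.
  intros Hab Hg Hle.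
  apply (CI_norm_le g (fun _ => M) a b); auto.
  rewrite Rmult_comm. apply (is_RInt_const (V := R_NormedModule)).
Qed.

Lemma is_vderive_affine f p q t l : is_cderive f (p + RtoC t * q) l ->
  is_vderive (fun u => f (p + RtoC u * q)) t (l * q).
Proof.
  intros H. apply is_vderiveP. intros eps He.
  assert (Q := Cmod_ge_0 q).
  destruct (proj1 (is_cderiveP _ _ _) H (eps / (Cmod q + 1))%R) as [d [D E]].
  { apply Rdiv_lt_0_compat; lra. }
  exists (d / (Cmod q + 1))%R. split; [apply Rdiv_lt_0_compat; lra|].
  intros u Hu.
  assert (K : (p + RtoC u * q - (p + RtoC t * q)) = RtoC (u - t) * q)
    by (rewrite RtoC_minus; ring).
  specialize (E (p + RtoC u * q)). rewrite K in E.
  rewrite Cmod_mult, Cmod_R in E.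
  replace (RtoC (u - t) * (l * q)) with (l * (RtoC (u - t) * q)) by ring.
  assert (X := Rabs_pos (u - t)).
  eapply Rle_trans; [apply E|].
  - apply Rle_lt_trans with (Rabs (u - t) * (Cmod q + 1))%R; [nra|].
    apply Rmult_lt_reg_r with (/ (Cmod q + 1))%R; [apply Rinv_0_lt_compat; lra|].
    rewrite Rmult_assoc, Rinv_r by lra. unfold Rdiv in Hu. lra.
  - replace (eps / (Cmod q + 1) * (Rabs (u - t) * Cmod q))%R with
      (eps * Rabs (u - t) * (Cmod q / (Cmod q + 1)))%R by (field; lra).
    rewrite <- (Rmult_1_r (eps * Rabs (u - t))) at 2.
    apply Rmult_le_compat_l; [nra|].
    apply Rmult_le_reg_r with (Cmod q + 1)%R; [lra|].
    unfold Rdiv; rewrite Rmult_assoc, Rinv_l; lra.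
Qed.

Lemma CI_FTC (f df : C -> C) p q a b : (a <= b)%R ->
  (forall t, (a <= t <= b)%R -> is_cderive f (p + RtoC t * q) (df (p + RtoC t * q))) ->
  (forall t, (a <= t <= b)%R -> vcont (fun t => df (p + RtoC t * q)) t) ->
  CI (fun t => df (p + RtoC t * q) * q) a b = f (p + RtoC b * q) - f (p + RtoC a * q).
Proof.
  intros Hab Hd Hc. apply CI_unique.
  apply (is_RInt_derive (V := C_R_CompleteNormedModule) (fun t => f (p + RtoC t * q))).
  - intros t. rewrite Rmin_left, Rmax_right by exact Hab. intros Ht.
    apply is_vderive_affine. auto.
  - intros t. rewrite Rmin_left, Rmax_right by exact Hab. intros Ht.
    apply (vcont_mult (fun t => df (p + RtoC t * q)) (fun _ => q)); auto. apply vcont_const.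
Qed.

(** * Goursat's theorem *)

(* Nested bisection (Cousin's lemma). *)
Lemma rectangle_induction (P : R -> R -> R -> R -> Prop) (a0 b0 c0 d0 : R) :
  (a0 <= b0)%R -> (c0 <= d0)%R ->
  (forall a b c d, (a0 <= a -> a <= b -> b <= b0 -> c0 <= c -> c <= d -> d <= d0 ->
     P a ((a + b) / 2) c ((c + d) / 2) -> P ((a + b) / 2) b c ((c + d) / 2) ->
     P a ((a + b) / 2) ((c + d) / 2) d -> P ((a + b) / 2) b ((c + d) / 2) d ->
     P a b c d)%R) ->
  (forall x y, (a0 <= x <= b0)%R -> (c0 <= y <= d0)%R ->
     exists r : R, (0 < r)%R /\
       forall a b c d, (a0 <= a <= x -> x <= b <= b0 -> c0 <= c <= y -> y <= d <= d0 ->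
         b - a < r -> d - c < r -> P a b c d)%R) ->
  P a0 b0 c0 d0.
Proof.
  intros Hab Hcd Hsub Hloc. apply NNPP; intros HN.
  pose (bad := fun q : (R * R) * (R * R) =>
    ~ P (fst (fst q)) (snd (fst q)) (fst (snd q)) (snd (snd q))).
  pose (inside := fun q q' : (R * R) * (R * R) =>
    (fst (fst q) <= fst (fst q') /\ fst (fst q') <= snd (fst q') /\
     snd (fst q') <= snd (fst q) /\ fst (snd q) <= fst (snd q') /\
     fst (snd q') <= snd (snd q') /\ snd (snd q') <= snd (snd q) /\
     snd (fst q') - fst (fst q') = (snd (fst q) - fst (fst q)) / 2 /\
     snd (snd q') - fst (snd q') = (snd (snd q) - fst (snd q)) / 2)%R).
  pose (ok := fun q : (R * R) * (R * R) =>
    (a0 <= fst (fst q) /\ fst (fst q) <= snd (fst q) /\ snd (fst q) <= b0 /\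
     c0 <= fst (snd q) /\ fst (snd q) <= snd (snd q) /\ snd (snd q) <= d0)%R /\ bad q).
  assert (Hstep : forall q, ok q -> exists q', ok q' /\ inside q q').
  { intros [[a b] [c d]] [[H1 [H2 [H3 [H4 [H5 H6]]]]] HB]; simpl in *.
    apply NNPP; intros HC. apply HB; simpl.
    apply Hsub; auto; apply NNPP; intros HD; apply HC.
    - exists ((a, (a + b) / 2), (c, (c + d) / 2))%R. unfold ok, inside, bad; simpl.
      repeat split; auto; lra.
    - exists (((a + b) / 2, b), (c, (c + d) / 2))%R. unfold ok, inside, bad; simpl.
      repeat split; auto; lra.
    - exists ((a, (a + b) / 2), ((c + d) / 2, d))%R. unfold ok, inside, bad; simpl.
      repeat split; auto; lra.
    - exists (((a + b) / 2, b), ((c + d) / 2, d))%R. unfold ok, inside, bad; simpl.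
      repeat split; auto; lra. }
  assert (Hf : exists F : (R * R) * (R * R) -> (R * R) * (R * R),
            forall q, ok q -> ok (F q) /\ inside q (F q)).
  { exists (fun q => epsilon (inhabits q) (fun q' => ok q' /\ inside q q')).
    intros q Hq. apply epsilon_spec. apply Hstep; exact Hq. }
  destruct Hf as [F HF].
  pose (s := fix s (n : nat) := match n with O => ((a0, b0), (c0, d0)) | S n => F (s n) end).
  assert (Hok : forall n, ok (s n)).
  { induction n; [|apply HF; exact IHn]. unfold ok, bad; simpl. repeat split; auto; lra. }
  assert (Hin : forall n, inside (s n) (s (S n))) by (intros n; apply HF, Hok).
  assert (Hlen : forall n, (snd (fst (s n)) - fst (fst (s n)) = (b0 - a0) * (/ 2) ^ n /\
      snd (snd (s n)) - fst (snd (s n)) = (d0 - c0) * (/ 2) ^ n)%R).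
  { induction n.
    - simpl. split; ring.
    - destruct (Hin n) as (_ & _ & _ & _ & _ & _ & E1 & E2). destruct IHn as [E3 E4].
      rewrite E1, E2, E3, E4. simpl. split; field. }
  assert (Hmon : forall n m,
    (fst (fst (s n)) <= fst (fst (s (n + m)%nat)) /\ snd (fst (s (n + m)%nat)) <= snd (fst (s n)) /\
     fst (snd (s n)) <= fst (snd (s (n + m)%nat)) /\ snd (snd (s (n + m)%nat)) <= snd (snd (s n)))%R).
  { intros n m. induction m.
    - rewrite Nat.add_0_r. lra.
    - rewrite Nat.add_succ_r.
      destruct (Hin (n + m)%nat) as (E1 & E2 & E3 & E4 & E5 & E6 & _). lra. }
  assert (Hlu : forall n m,
    (fst (fst (s n)) <= snd (fst (s m)) /\ fst (snd (s n)) <= snd (snd (s m)))%R).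
  { intros n m.
    destruct (Hmon n m) as (E1 & E2 & E3 & E4).
    destruct (Hmon m n) as (E1' & E2' & E3' & E4').
    rewrite (Nat.add_comm m n) in *.
    destruct (Hok (n + m)%nat) as [(_ & E5 & _ & _ & E6 & _) _]. lra. }
  assert (Hsup : forall u v : nat -> R, (forall n m, u n <= v m)%R ->
    exists x, forall n, (u n <= x <= v n)%R).
  { intros u v Huv.
    destruct (completeness (fun x => exists n, x = u n)) as [x [Hx1 Hx2]].
    - exists (v O). intros x [n ->]. auto.
    - exists (u O). exists O; auto.
    - exists x. intros n. split; [apply Hx1; exists n; auto|].
      apply Hx2. intros y [m ->]. auto. }
  destruct (Hsup (fun n => fst (fst (s n))) (fun n => snd (fst (s n)))) as [x Hx].
  { intros n m; apply Hlu. }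
  destruct (Hsup (fun n => fst (snd (s n))) (fun n => snd (snd (s n)))) as [y Hy].
  { intros n m; apply Hlu. }
  destruct (Hloc x y (Hx O) (Hy O)) as [r [Hr HP]].
  assert (Hpow : exists n, ((b0 - a0) * (/ 2) ^ n < r /\ (d0 - c0) * (/ 2) ^ n < r)%R).
  { destruct (pow_lt_1_zero (/ 2) ltac:(rewrite Rabs_right; lra) (r / (b0 - a0 + (d0 - c0) + 1)))
      as [n Hn]; [apply Rdiv_lt_0_compat; lra|].
    exists n. specialize (Hn n (le_n n)).
    assert (Hp : (0 < (/ 2) ^ n)%R) by (apply pow_lt; lra).
    rewrite Rabs_right in Hn by lra.
    assert ((b0 - a0 + (d0 - c0) + 1) * (/ 2) ^ n < r)%R.
    { apply Rmult_lt_reg_r with (/ (b0 - a0 + (d0 - c0) + 1))%R; [apply Rinv_0_lt_compat; lra|].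
      replace ((b0 - a0 + (d0 - c0) + 1) * (/ 2) ^ n * / (b0 - a0 + (d0 - c0) + 1))%R
        with ((/ 2) ^ n)%R by (field; lra).
      exact Hn. }
    nra. }
  destruct Hpow as [n [Hn1 Hn2]].
  destruct (Hok n) as [(E1 & E2 & E3 & E4 & E5 & E6) HB]. apply HB.
  destruct (Hlen n) as [L1 L2].
  apply HP; try lra; split; auto; try apply Hx; try apply Hy.
Qed.

(** Cousin's lemma stands in for compactness: a differentiable function is bounded near each point,
    and the sum of the bounds on the four quarters bounds a rectangle. The square of half-side [r]
    around the disc reaches at most modulus 2 r, whence the radius in the hypothesis. *)
Lemma cderivable_bounded (f : C -> C) (r : R) :
  (forall z, (Cmod z <= 2 * r)%R -> exists l, is_cderive f z l) -> (0 <= r)%R ->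
  exists M, (0 < M)%R /\ forall z, (Cmod z <= r)%R -> (Cmod (f z) <= M)%R.
Proof.
  intros Hf Hr.
  assert (H : exists M, (0 < M)%R /\
    forall x y, (- r <= x <= r)%R -> (- r <= y <= r)%R -> (Cmod (f (x, y)) <= M)%R).
  { apply (rectangle_induction (fun a b c d => exists M, (0 < M)%R /\
      forall x y, (a <= x <= b)%R -> (c <= y <= d)%R -> (Cmod (f (x, y)) <= M)%R)); try lra.
    - intros a b c d _ _ _ _ _ _ [M1 [P1 H1]] [M2 [P2 H2]] [M3 [P3 H3]] [M4 [P4 H4]].
      exists (M1 + M2 + M3 + M4)%R. split; [lra|]. intros x y Hx Hy.
      destruct (Rle_lt_dec x ((a + b) / 2)), (Rle_lt_dec y ((c + d) / 2)).
      + specialize (H1 x y ltac:(lra) ltac:(lra)). lra.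
      + specialize (H3 x y ltac:(lra) ltac:(lra)). lra.
      + specialize (H2 x y ltac:(lra) ltac:(lra)). lra.
      + specialize (H4 x y ltac:(lra) ltac:(lra)). lra.
    - intros x y Hx Hy.
      destruct (Hf (x, y)) as [l Hl].
      { eapply Rle_trans; [apply Cmod_le_Re_Im|]. simpl.
        assert (Rabs x <= r)%R by (apply Rabs_le; lra).
        assert (Rabs y <= r)%R by (apply Rabs_le; lra). lra. }
      destruct (is_cderive_continuous _ _ _ Hl 1 ltac:(lra)) as [d [D E]].
      exists (d / 2)%R. split; [lra|]. intros a b c e Ha Hb Hc He Hba Hec.
      exists (Cmod (f (x, y)) + 1)%R. split; [assert (X := Cmod_ge_0 (f (x, y))); lra|].
      intros u v Hu Hv.
      replace (f (u, v)) with (f (x, y) + (f (u, v) - f (x, y))) by ring.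
      eapply Rle_trans; [apply Cmod_triangle|].
      apply Rplus_le_compat_l, E.
      eapply Rle_lt_trans; [apply Cmod_le_Re_Im|]. simpl.
      assert (Rabs (u + - x) < d / 2)%R by (apply Rabs_def1; lra).
      assert (Rabs (v + - y) < d / 2)%R by (apply Rabs_def1; lra). lra. }
  destruct H as [M [HM H]]. exists M. split; auto.
  intros [x y] Hz. apply H.
  - assert (T := re_le_Cmod (x, y)). simpl in T. apply Rabs_le_between. lra.
  - assert (T := im_le_Cmod (x, y)). simpl in T. apply Rabs_le_between. lra.
Qed.

Definition seg_int (F : C -> C) (p q : C) (a b : R) : C :=
  CI (fun t => F (p + RtoC t * q)) a b.

(* Counterclockwise integral of F dz along the boundary of [a,b] x [c,d]. *)
Definition rect_int (F : C -> C) (a b c d : R) : C :=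
  seg_int F (RtoC c * Ci) 1 a b - seg_int F (RtoC d * Ci) 1 a b
  + Ci * (seg_int F (RtoC b) Ci c d - seg_int F (RtoC a) Ci c d).

Definition cderivable_on_rect (F : C -> C) (a b c d : R) : Prop :=
  forall x y, (a <= x <= b)%R -> (c <= y <= d)%R ->
    exists l, is_cderive F (RtoC x + RtoC y * Ci) l.

Section RectangleSides.
Variables (F : C -> C) (a b c d : R).
Hypothesis HF : cderivable_on_rect F a b c d.

Lemma vcont_on_horizontal y : (c <= y <= d)%R ->
  vcont_on (fun t => F (RtoC y * Ci + RtoC t * 1)) a b.
Proof.
  intros Hy t Ht. destruct (HF t y Ht Hy) as [l Hl].
  apply (vcont_comp F (fun t => RtoC y * Ci + RtoC t * 1) t l); [|apply vcont_affine].
  replace (RtoC y * Ci + RtoC t * 1) with (RtoC t + RtoC y * Ci) by ring. exact Hl.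
Qed.

Lemma vcont_on_vertical x : (a <= x <= b)%R ->
  vcont_on (fun t => F (RtoC x + RtoC t * Ci)) c d.
Proof.
  intros Hx t Ht. destruct (HF x t Hx Ht) as [l Hl].
  apply (vcont_comp F (fun t => RtoC x + RtoC t * Ci) t l); [exact Hl|apply vcont_affine].
Qed.

End RectangleSides.

Lemma cderivable_on_rect_sub F a b c d a' b' c' d' :
  cderivable_on_rect F a b c d -> (a <= a' -> b' <= b -> c <= c' -> d' <= d ->
  cderivable_on_rect F a' b' c' d')%R.
Proof. intros H H1 H2 H3 H4 x y Hx Hy. apply H; lra. Qed.

Lemma rect_int_split F a b c d :
  cderivable_on_rect F a b c d -> (a <= b)%R -> (c <= d)%R ->
  rect_int F a b c d =
  rect_int F a ((a + b) / 2) c ((c + d) / 2) + rect_int F ((a + b) / 2) b c ((c + d) / 2) +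
  (rect_int F a ((a + b) / 2) ((c + d) / 2) d + rect_int F ((a + b) / 2) b ((c + d) / 2) d).
Proof.
  intros HF Hab Hcd. set (m := ((a + b) / 2)%R). set (n := ((c + d) / 2)%R).
  assert (Hm : (a <= m <= b)%R) by (unfold m; lra).
  assert (Hn : (c <= n <= d)%R) by (unfold n; lra).
  assert (EH : forall y, (c <= y <= d)%R ->
    seg_int F (RtoC y * Ci) 1 a b = seg_int F (RtoC y * Ci) 1 a m + seg_int F (RtoC y * Ci) 1 m b).
  { intros y Hy. apply CI_Chasles; try tauto. apply (vcont_on_horizontal F a b c d); auto. }
  assert (EV : forall x, (a <= x <= b)%R ->
    seg_int F (RtoC x) Ci c d = seg_int F (RtoC x) Ci c n + seg_int F (RtoC x) Ci n d).
  { intros x Hx. apply CI_Chasles; try tauto. apply (vcont_on_vertical F a b c d); auto. }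
  unfold rect_int.
  rewrite (EH c), (EH d), (EV a), (EV b) by lra. ring.
Qed.

Lemma rect_int_plus F G a b c d :
  cderivable_on_rect F a b c d -> cderivable_on_rect G a b c d ->
  (a <= b)%R -> (c <= d)%R ->
  rect_int (fun w => F w + G w) a b c d = rect_int F a b c d + rect_int G a b c d.
Proof.
  intros HF HG Hab Hcd. unfold rect_int, seg_int.
  rewrite !CI_plus; auto;
    try (apply (vcont_on_horizontal _ a b c d); auto; lra);
    try (apply (vcont_on_vertical _ a b c d); auto; lra).
  ring.
Qed.

(** An affine function has the primitive [P], so each side contributes a difference of corner values
    and these cancel around the rectangle. Tangent maps can therefore be subtracted from [F] at
    will. *)
Lemma rect_int_affine u v a b c d : (a <= b)%R -> (c <= d)%R ->
  rect_int (fun w => u + v * w) a b c d = 0.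
Proof.
  intros Hab Hcd.
  set (P := fun w => u * w + v * (w * w) * / 2).
  assert (HP : forall w, is_cderive P w (u + v * w)).
  { intros w. unfold P. eapply is_cderive_eq.
    - apply is_cderive_plus.
      + apply is_cderive_mult; [apply is_cderive_const|apply is_cderive_id].
      + apply is_cderive_mult; [|apply is_cderive_const].
        apply is_cderive_mult; [apply is_cderive_const|].
        apply is_cderive_mult; apply is_cderive_id.
    - cbv beta. field. }
  assert (HI : forall p q s t, (s <= t)%R ->
    seg_int (fun w => u + v * w) p q s t * q = P (p + RtoC t * q) - P (p + RtoC s * q)).
  { intros p q s t Hst. unfold seg_int.
    assert (HC : vcont_on (fun t => u + v * (p + RtoC t * q)) s t).
    { intros r _. apply vcont_plus; [apply vcont_const|]. apply vcont_scal, vcont_affine. }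
    rewrite Cmult_comm, <- CI_scal by auto.
    rewrite <- (CI_FTC P (fun w => u + v * w)); auto.
    apply CI_ext; auto. intros; ring. }
  assert (HV : forall x, seg_int (fun w => u + v * w) (RtoC x) Ci c d =
      - Ci * (P (RtoC x + RtoC d * Ci) - P (RtoC x + RtoC c * Ci))).
  { intros x. rewrite <- (HI (RtoC x) Ci c d Hcd).
    rewrite Cmult_comm, <- Cmult_assoc. replace (Ci * - Ci) with (RtoC 1); [ring|].
    unfold Ci, Copp, Cmult, RtoC; simpl; f_equal; ring. }
  unfold rect_int.
  rewrite <- (Cmult_1_r (seg_int _ (RtoC c * Ci) 1 a b)), <- (Cmult_1_r (seg_int _ (RtoC d * Ci) 1 a b)).
  rewrite !HI, !HV by auto.
  replace (RtoC c * Ci + RtoC b * 1) with (RtoC b + RtoC c * Ci) by ring.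
  replace (RtoC c * Ci + RtoC a * 1) with (RtoC a + RtoC c * Ci) by ring.
  replace (RtoC d * Ci + RtoC b * 1) with (RtoC b + RtoC d * Ci) by ring.
  replace (RtoC d * Ci + RtoC a * 1) with (RtoC a + RtoC d * Ci) by ring.
  set (x1 := P _). set (x2 := P _). set (x3 := P _). set (x4 := P _).
  assert (EC : Ci * Ci = - (1)).
  { unfold Ci, Copp, Cmult, RtoC; simpl; f_equal; ring. }
  transitivity (x1 - x2 - (x3 - x4) + (Ci * Ci) * (- (x3 - x1) + (x4 - x2))); [ring|].
  rewrite EC. ring.
Qed.

Lemma rect_int_bound (F : C -> C) (a b c d M : R) :
  cderivable_on_rect F a b c d -> (a <= b)%R -> (c <= d)%R ->
  (forall x y, (a <= x <= b)%R -> (c <= y <= d)%R -> (Cmod (F (RtoC x + RtoC y * Ci)%C) <= M)%R) ->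
  (Cmod (rect_int F a b c d) <= 2 * M * ((b - a) + (d - c)))%R.
Proof.
  intros HF Hab Hcd HM.
  assert (HH : forall y, (c <= y <= d)%R -> (Cmod (seg_int F (RtoC y * Ci) 1 a b) <= M * (b - a))%R).
  { intros y Hy. apply CI_bound; auto.
    - apply (vcont_on_horizontal F a b c d); auto.
    - intros t Ht. replace (RtoC y * Ci + RtoC t * 1) with (RtoC t + RtoC y * Ci) by ring. auto. }
  assert (HV : forall x, (a <= x <= b)%R -> (Cmod (seg_int F (RtoC x) Ci c d) <= M * (d - c))%R).
  { intros x Hx. apply CI_bound; auto. apply (vcont_on_vertical F a b c d); auto. }
  unfold rect_int, Cminus.
  eapply Rle_trans; [apply Cmod_triangle|].
  rewrite Cmod_mult, Cmod_Ci.
  assert (T1 := Cmod_triangle (seg_int F (RtoC c * Ci) 1 a b) (- seg_int F (RtoC d * Ci) 1 a b)).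
  assert (T2 := Cmod_triangle (seg_int F (RtoC b) Ci c d) (- seg_int F (RtoC a) Ci c d)).
  rewrite Cmod_opp in T1, T2.
  assert (X1 := HH c ltac:(lra)). assert (X2 := HH d ltac:(lra)).
  assert (X3 := HV a ltac:(lra)). assert (X4 := HV b ltac:(lra)). lra.
Qed.

(** The square of the half-perimeter is compatible with bisection: each quarter has a quarter of it.
    On a small rectangle around a point, [F] may be replaced by its first-order remainder, of size
    eps / 2 times the half-perimeter, on a contour of twice that length. *)
Lemma Goursat_bound (F : C -> C) (a b c d eps : R) :
  cderivable_on_rect F a b c d -> (a <= b)%R -> (c <= d)%R -> (0 < eps)%R ->
  (Cmod (rect_int F a b c d) <= eps * ((b - a) + (d - c)) ^ 2)%R.
Proof.
  intros HF Hab Hcd Heps.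
  apply (rectangle_induction (fun a b c d =>
    Cmod (rect_int F a b c d) <= eps * ((b - a) + (d - c)) ^ 2)%R); auto.
  - intros a' b' c' d' Ha Hab' Hb Hc Hcd' Hd H1 H2 H3 H4.
    rewrite rect_int_split by (try apply (cderivable_on_rect_sub F a b c d); auto).
    eapply Rle_trans; [apply Cmod_triangle|].
    eapply Rle_trans; [apply Rplus_le_compat; apply Cmod_triangle|].
    simpl in *. nra.
  - intros x y Hx Hy. destruct (HF x y Hx Hy) as [l Hl].
    destruct (proj1 (is_cderiveP _ _ _) Hl (eps / 2)%R ltac:(lra)) as [r [Hr H]].
    exists (r / 2)%R. split; [lra|]. intros a' b' c' d' Ha Hb Hc Hd Hba Hdc.
    set (z := RtoC x + RtoC y * Ci) in *.
    assert (HFs : cderivable_on_rect F a' b' c' d')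
      by (apply (cderivable_on_rect_sub F a b c d); auto; lra).
    assert (HA : forall u v, cderivable_on_rect (fun w => u + v * w) a' b' c' d').
    { intros u v x' y' _ _. exists v. apply is_cderive_affine. }
    set (R0 := fun w => F w + ((l * z - F z) + (- l) * w)).
    assert (HR0 : cderivable_on_rect R0 a' b' c' d').
    { intros x' y' Hx' Hy'. destruct (HFs x' y' Hx' Hy') as [l' Hl'].
      exists (l' + - l). apply is_cderive_plus; auto. apply is_cderive_affine. }
    assert (E : rect_int F a' b' c' d' = rect_int R0 a' b' c' d').
    { unfold R0. rewrite rect_int_plus by (auto; lra). rewrite rect_int_affine by lra. ring. }
    rewrite E.
    replace (eps * (b' - a' + (d' - c')) ^ 2)%R with
      (2 * (eps / 2 * (b' - a' + (d' - c'))) * (b' - a' + (d' - c')))%R by field.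
    apply rect_int_bound; auto; try lra.
    intros x' y' Hx' Hy'. set (w := RtoC x' + RtoC y' * Ci).
    assert (Hwz : (Cmod (w - z) <= b' - a' + (d' - c'))%R).
    { eapply Rle_trans; [apply Cmod_le_Re_Im|].
      unfold w, z; simpl.
      apply Rplus_le_compat; apply Rabs_le; lra. }
    unfold R0. replace (F w + (l * z - F z + - l * w)) with (F w - F z - l * (w - z)) by ring.
    eapply Rle_trans; [apply H; lra|]. apply Rmult_le_compat_l; lra.
Qed.

Lemma Goursat F a b c d :
  cderivable_on_rect F a b c d -> (a <= b)%R -> (c <= d)%R -> rect_int F a b c d = 0.
Proof.
  intros HF Hab Hcd. apply Cmod_eq_0. apply Rle_antisym; [|apply Cmod_ge_0].
  apply le_epsilon. intros eps He.
  set (s := ((b - a) + (d - c))%R). assert (Hs : (0 <= s)%R) by (unfold s; lra).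
  eapply Rle_trans; [apply (Goursat_bound F a b c d (eps / (s ^ 2 + 1))); auto|].
  - apply Rdiv_lt_0_compat; [lra|]. simpl; nra.
  - fold s. rewrite Rplus_0_l.
    apply Rmult_le_reg_r with (s ^ 2 + 1)%R; [simpl; nra|].
    replace (eps / (s ^ 2 + 1) * s ^ 2 * (s ^ 2 + 1))%R with (eps * s ^ 2)%R
      by (field; simpl; nra).
    apply Rmult_le_compat_l; lra.
Qed.

(** * Integrals over circles *)

Definition cis (t : R) : C := Cexp (RtoC t * Ci).

Lemma Cmod_cis t : Cmod (cis t) = 1%R.
Proof.
  unfold cis. rewrite Cmod_Cexp.
  replace (Re (RtoC t * Ci)) with 0%R by (simpl; ring). apply exp_0.
Qed.

Lemma cis_2PI : cis (2 * PI) = 1.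
Proof.
  unfold cis, Cexp; simpl.
  replace (2 * PI * 0 - 0 * 1)%R with 0%R by ring.
  replace (2 * PI * 1 + 0 * 0)%R with (2 * PI)%R by ring.
  rewrite exp_0, cos_2PI, sin_2PI. unfold RtoC; f_equal; ring.
Qed.

Lemma Cexp_RtoC (x : R) : Cexp (RtoC x) = RtoC (exp x).
Proof. unfold Cexp; simpl. rewrite cos_0, sin_0. unfold RtoC; f_equal; ring. Qed.

Lemma Cexp_opp z : Cexp (- z) = / Cexp z.
Proof.
  assert (H : Cexp z * Cexp (- z) = 1).
  { rewrite <- Cexp_plus. replace (z + - z) with (RtoC 0) by ring. apply Cexp_0. }
  assert (N := Cexp_neq_0 z).
  transitivity (/ Cexp z * (Cexp z * Cexp (- z))); [field; auto|]. rewrite H. ring.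
Qed.

Lemma Cexp_2PI_opp n : Cexp (n * (RtoC (2 * PI) * Ci)) = 1 ->
  Cexp (- n * (RtoC (2 * PI) * Ci)) = 1.
Proof.
  intros H. replace (- n * (RtoC (2 * PI) * Ci)) with (- (n * (RtoC (2 * PI) * Ci))) by ring.
  rewrite Cexp_opp, H. field.
Qed.

Lemma vcont_Cexp g t : vcont g t -> vcont (fun u => Cexp (g u)) t.
Proof. intros H. exact (vcont_comp Cexp g t _ (is_cderive_Cexp _) H). Qed.

Lemma vcont_turn n t : vcont (fun t => Cexp (n * (RtoC t * Ci))) t.
Proof.
  apply vcont_Cexp, vcont_scal.
  apply vcont_ext with (fun u => 0 + RtoC u * Ci); [intros; ring|apply vcont_affine].
Qed.

Lemma vcont_cis t : vcont cis t.
Proof.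
  apply vcont_ext with (fun t => Cexp (1 * (RtoC t * Ci)));
    [intros; unfold cis; f_equal; ring|apply vcont_turn].
Qed.

Lemma vcont_cis_opp t : vcont (fun t => cis (- t)) t.
Proof.
  apply vcont_ext with (fun t => Cexp (- (1) * (RtoC t * Ci)));
    [intros; unfold cis; f_equal; rewrite RtoC_opp; ring|apply vcont_turn].
Qed.

Lemma two_PI_ge_0 : (0 <= 2 * PI)%R.
Proof. assert (H := PI_RGT_0). lra. Qed.

(** The first hypothesis makes [n] an integer without a separate integer type; the same complex
    number then serves in the exponent and as a factor. *)
Lemma CI_turn n : Cexp (n * (RtoC (2 * PI) * Ci)) = 1 -> n <> 0 ->
  CI (fun t => Cexp (n * (RtoC t * Ci))) 0 (2 * PI) = 0.
Proof.
  intros Hn N0.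
  assert (H : CI (fun t => (fun w => n * Cexp w) (0 + RtoC t * (n * Ci)) * (n * Ci)) 0 (2 * PI) =
      n * Cexp (0 + RtoC (2 * PI) * (n * Ci)) - n * Cexp (0 + RtoC 0 * (n * Ci))).
  { apply (CI_FTC (fun w => n * Cexp w) (fun w => n * Cexp w)).
    - apply two_PI_ge_0.
    - intros t _. eapply is_cderive_eq.
      + apply is_cderive_mult; [apply is_cderive_const|apply is_cderive_Cexp].
      + cbv beta. ring.
    - intros t _. apply vcont_scal, vcont_Cexp, vcont_affine. }
  replace (0 + RtoC (2 * PI) * (n * Ci)) with (n * (RtoC (2 * PI) * Ci)) in H by ring.
  replace (0 + RtoC 0 * (n * Ci)) with (RtoC 0) in H by ring.
  rewrite Hn, Cexp_0 in H. replace (n * 1 - n * 1) with (RtoC 0) in H by ring.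
  assert (NI : Ci <> 0) by (apply Cmod_gt_0; rewrite Cmod_Ci; lra).
  assert (Hk : n * n * Ci <> 0) by (repeat apply Cmult_neq_0; auto).
  rewrite (CI_ext _ (fun t => n * n * Ci * Cexp (n * (RtoC t * Ci)))) in H.
  - rewrite CI_scal in H; [|apply two_PI_ge_0|intros t _; apply vcont_turn].
    destruct (Ceq_dec (CI (fun t => Cexp (n * (RtoC t * Ci))) 0 (2 * PI)) 0) as [E|E]; auto.
    exfalso. revert H. apply Cmult_neq_0; auto.
  - apply two_PI_ge_0.
  - intros t _. replace (0 + RtoC t * (n * Ci)) with (n * (RtoC t * Ci)) by ring. ring.
Qed.

Definition cderivable_on_disc (f : C -> C) (z : C) (r : R) : Prop :=
  forall w, (Cmod (w - z) <= r)%R -> exists l, is_cderive f w l.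

(* In the logarithmic coordinate s + i t, circles are vertical segments of
   length 2 pi, and Goursat's theorem makes the integral independent of s. *)
Lemma log_circle_int_const (F : C -> C) (a b : R) : (a <= b)%R ->
  cderivable_on_rect F a b 0 (2 * PI) ->
  (forall w, F (w + RtoC (2 * PI) * Ci) = F w) ->
  CI (fun t => F (RtoC a + RtoC t * Ci)) 0 (2 * PI) =
  CI (fun t => F (RtoC b + RtoC t * Ci)) 0 (2 * PI).
Proof.
  intros Hab HF Hper.
  assert (G := Goursat F a b 0 (2 * PI) HF Hab two_PI_ge_0).
  unfold rect_int in G.
  assert (E : seg_int F (RtoC 0 * Ci) 1 a b = seg_int F (RtoC (2 * PI) * Ci) 1 a b).
  { apply CI_ext; auto. intros t _. rewrite <- Hper. f_equal. ring. }
  rewrite E in G.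
  change (seg_int F (RtoC a) Ci 0 (2 * PI) = seg_int F (RtoC b) Ci 0 (2 * PI)).
  set (x := seg_int F (RtoC b) Ci 0 (2 * PI)) in *.
  set (y := seg_int F (RtoC a) Ci 0 (2 * PI)) in *.
  assert (EC : Ci * Ci = - (1)) by (unfold Ci, Copp, Cmult, RtoC; simpl; f_equal; ring).
  set (u := seg_int F (RtoC (2 * PI) * Ci) 1 a b) in *.
  transitivity (x + (Ci * Ci) * x - (Ci * Ci) * y); [rewrite EC; ring|].
  transitivity (x + Ci * (u - u + Ci * (x - y))); [ring|]. rewrite G. ring.
Qed.

(** With the first-order Taylor polynomial subtracted, the integrand in the logarithmic coordinate
    is o(e^s) e^(s Re n), which tends to 0 as s goes to minus infinity because Re n >= -1. The
    integral does not depend on s, so it is 0. This includes n = -1, the case of Cauchy's formula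
    for the derivative. *)
Lemma circle_int_remainder f z r l (n : C) : (0 < r)%R -> cderivable_on_disc f z r ->
  is_cderive f z l -> (-1 <= Re n)%R -> Im n = 0%R -> Cexp (n * (RtoC (2 * PI) * Ci)) = 1 ->
  CI (fun t => (f (z + RtoC r * cis t) - f z - l * (RtoC r * cis t)) * Cexp (n * (RtoC t * Ci)))
    0 (2 * PI) = 0.
Proof.
  intros Hr Hf Hl Hn1 Hn2 Hn.
  set (F := fun w => (f (z + Cexp w) - f z - l * Cexp w) * Cexp (n * w)).
  assert (HFd : forall s y, (s <= ln r)%R -> exists l, is_cderive F (RtoC s + RtoC y * Ci) l).
  { intros s y Hs. set (w := RtoC s + RtoC y * Ci).
    destruct (Hf (z + Cexp w)) as [l' Hl'].
    { replace (z + Cexp w - z) with (Cexp w) by ring. rewrite Cmod_Cexp.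
      unfold w. replace (Re (RtoC s + RtoC y * Ci)) with s by (simpl; ring).
      rewrite <- (exp_ln r Hr). destruct Hs as [Hs|Hs]; [left; apply exp_increasing; auto|right; f_equal; auto]. }
    eexists. unfold F. apply is_cderive_mult.
    - apply is_cderive_minus; [apply is_cderive_minus|].
      + apply (is_cderive_comp f (fun w => z + Cexp w)); [exact Hl'|].
        apply is_cderive_plus; [apply is_cderive_const|apply is_cderive_Cexp].
      + apply is_cderive_const.
      + apply is_cderive_mult; [apply is_cderive_const|apply is_cderive_Cexp].
    - apply (is_cderive_comp Cexp (fun w => n * w)); [apply is_cderive_Cexp|].
      apply is_cderive_mult; [apply is_cderive_const|apply is_cderive_id]. }
  assert (Hper : forall w, F (w + RtoC (2 * PI) * Ci) = F w).
  { intros w. unfold F. rewrite Cmult_plus_distr_l, !Cexp_plus, Hn.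
    fold (cis (2 * PI)). rewrite cis_2PI, !Cmult_1_r. reflexivity. }
  set (V := fun s => CI (fun t => F (RtoC s + RtoC t * Ci)) 0 (2 * PI)).
  assert (HV : forall s, (s <= ln r)%R -> V s = V (ln r)).
  { intros s Hs. apply log_circle_int_const; auto. intros x y Hx _. apply HFd. lra. }
  assert (HVc : forall s, (s <= ln r)%R -> vcont_on (fun t => F (RtoC s + RtoC t * Ci)) 0 (2 * PI)).
  { intros s Hs t _. destruct (HFd s t Hs) as [l' Hl'].
    apply (vcont_comp F (fun t => RtoC s + RtoC t * Ci) t l'); [exact Hl'|apply vcont_affine]. }
  assert (V0 : V (ln r) = 0).
  { apply Cmod_eq_0, Rle_antisym; [|apply Cmod_ge_0]. apply le_epsilon. intros eps He.
    rewrite Rplus_0_l.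
    assert (HP := PI_RGT_0).
    destruct (proj1 (is_cderiveP _ _ _) Hl (eps / (2 * PI))%R) as [d [Hd H]].
    { apply Rdiv_lt_0_compat; lra. }
    (* Three demands: s <= ln r stays in the disc, e^s < d brings e^w into the range of the
       derivative estimate, and s <= 0 turns Re n >= -1 into e^(s Re n) <= e^(-s). *)
    set (s := (Rmin (Rmin 0 (ln r)) (ln (d / 2)))%R).
    assert (S1 : (s <= 0)%R) by (eapply Rle_trans; [apply Rmin_l|apply Rmin_l]).
    assert (S2 : (s <= ln r)%R) by (eapply Rle_trans; [apply Rmin_l|apply Rmin_r]).
    assert (S3 : (exp s < d)%R).
    { apply Rle_lt_trans with (d / 2)%R; [|lra]. rewrite <- (exp_ln (d / 2)) by lra.
      destruct (Rmin_r (Rmin 0 (ln r)) (ln (d / 2))) as [T|T]; fold s in T.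
      - left; apply exp_increasing; auto.
      - right; f_equal; auto. }
    rewrite <- (HV s S2).
    replace eps with (eps / (2 * PI) * (2 * PI - 0))%R by (field; lra).
    apply CI_bound; [apply two_PI_ge_0|auto|].
    intros t _. unfold F. set (w := RtoC s + RtoC t * Ci).
    assert (Ew : Cmod (Cexp w) = exp s).
    { rewrite Cmod_Cexp. f_equal. unfold w; simpl; ring. }
    rewrite Cmod_mult.
    assert (X1 := H (z + Cexp w)).
    replace (z + Cexp w - z) with (Cexp w) in X1 by ring. rewrite Ew in X1.
    specialize (X1 S3).
    assert (X2 : (Cmod (Cexp (n * w)) <= exp (- s))%R).
    { rewrite Cmod_Cexp.
      replace (Re (n * w)) with (Re n * s)%R.
      - assert (L : (Re n * s <= - s)%R) by nra.
        destruct L as [L|L]; [left; apply exp_increasing; auto|right; f_equal; auto].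
      - unfold w. simpl. unfold Im in Hn2. rewrite Hn2. unfold Re. ring. }
    assert (X3 : (exp s * exp (- s) = 1)%R) by (rewrite <- exp_plus, Rplus_opp_r; apply exp_0).
    assert (X4 := exp_pos s). assert (X5 := exp_pos (- s)).
    assert (X6 := Cmod_ge_0 (f (z + Cexp w) - f z - l * Cexp w)).
    assert (X7 := Cmod_ge_0 (Cexp (n * w))).
    replace (eps / (2 * PI))%R with (eps / (2 * PI) * exp s * exp (- s))%R
      by (rewrite Rmult_assoc, X3; ring).
    apply Rmult_le_compat; auto. }
  assert (Er : exp (ln r) = r) by (apply exp_ln; auto).
  assert (EV : V (ln r) = Cexp (n * RtoC (ln r)) *
    CI (fun t => (f (z + RtoC r * cis t) - f z - l * (RtoC r * cis t)) * Cexp (n * (RtoC t * Ci)))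
    0 (2 * PI)).
  { assert (EF : forall t, F (RtoC (ln r) + RtoC t * Ci) = Cexp (n * RtoC (ln r)) *
     ((f (z + RtoC r * cis t) - f z - l * (RtoC r * cis t)) * Cexp (n * (RtoC t * Ci)))).
    { intros t. unfold F. rewrite Cmult_plus_distr_l, !Cexp_plus, Cexp_RtoC, Er.
      fold (cis t). ring. }
    unfold V. rewrite (CI_ext _ _ 0 (2 * PI) two_PI_ge_0 (fun t _ => EF t)).
    apply CI_scal; [apply two_PI_ge_0|].
    intros t Ht.
    apply vcont_ext with (fun t => Cexp (- (n * RtoC (ln r))) * F (RtoC (ln r) + RtoC t * Ci)).
    - intros u. rewrite EF, Cexp_opp. field. apply Cexp_neq_0.
    - apply vcont_scal. apply HVc; auto; lra. }
  rewrite V0 in EV.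
  destruct (Ceq_dec (CI (fun t => (f (z + RtoC r * cis t) - f z - l * (RtoC r * cis t)) *
    Cexp (n * (RtoC t * Ci))) 0 (2 * PI)) 0) as [E|E]; auto.
  exfalso. symmetry in EV. revert EV. apply Cmult_neq_0; [apply Cexp_neq_0|auto].
Qed.

Lemma vcont_on_circle f z r (g : R -> C) : (0 < r)%R -> cderivable_on_disc f z r ->
  (forall t, vcont g t) ->
  vcont_on (fun t => f (z + RtoC r * cis t) * g t) 0 (2 * PI).
Proof.
  intros Hr Hf Hg t _.
  apply (vcont_mult (fun t => f (z + RtoC r * cis t)) g); [|apply Hg].
  destruct (Hf (z + RtoC r * cis t)) as [l Hl].
  { replace (z + RtoC r * cis t - z) with (RtoC r * cis t) by ring.
    rewrite Cmod_mult, Cmod_cis, Cmod_R, Rabs_right; lra. }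
  apply (vcont_comp f (fun t => z + RtoC r * cis t) t l); [exact Hl|].
  apply vcont_plus; [apply vcont_const|]. apply vcont_scal.
  apply vcont_cis.
Qed.

Lemma Cminus_eq_0_uniq (x y : C) : x - y = 0 -> x = y.
Proof. intros H. replace x with (x - y + y) by ring. rewrite H. ring. Qed.

Lemma Cm1_nz : - (1) <> 0.
Proof. apply Cmod_gt_0. rewrite Cmod_m1. lra. Qed.

(** One formula for three facts: n = 0 is the mean value property, n = -1 is Cauchy's formula for
    the derivative, and n = 1 is the vanishing of the Fourier coefficient of index -1. *)
Lemma circle_int f z r l (n : C) : (0 < r)%R -> cderivable_on_disc f z r ->
  is_cderive f z l -> (-1 <= Re n)%R -> Im n = 0%R -> Cexp (n * (RtoC (2 * PI) * Ci)) = 1 ->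
  CI (fun t => f (z + RtoC r * cis t) * Cexp (n * (RtoC t * Ci))) 0 (2 * PI) =
  f z * CI (fun t => Cexp (n * (RtoC t * Ci))) 0 (2 * PI) +
  l * RtoC r * CI (fun t => Cexp ((n + 1) * (RtoC t * Ci))) 0 (2 * PI).
Proof.
  intros Hr Hf Hl H1 H2 H3.
  assert (H := circle_int_remainder f z r l n Hr Hf Hl H1 H2 H3).
  rewrite (CI_ext _ (fun t => f (z + RtoC r * cis t) * Cexp (n * (RtoC t * Ci)) -
     (f z * Cexp (n * (RtoC t * Ci)) + l * RtoC r * Cexp ((n + 1) * (RtoC t * Ci))))) in H.
  - assert (T := two_PI_ge_0).
    assert (HC1 : vcont_on (fun t => f z * Cexp (n * (RtoC t * Ci))) 0 (2 * PI))
      by (intros t _; apply vcont_scal, vcont_turn).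
    assert (HC2 : vcont_on (fun t => l * RtoC r * Cexp ((n + 1) * (RtoC t * Ci))) 0 (2 * PI))
      by (intros t _; apply vcont_scal, vcont_turn).
    rewrite CI_minus in H; auto.
    + rewrite CI_plus in H by auto.
      rewrite !CI_scal in H by (auto; intros t _; apply vcont_turn).
      apply Cminus_eq_0_uniq. rewrite <- H. ring.
    + apply vcont_on_circle; auto. intros; apply vcont_turn.
    + intros t Ht. apply vcont_plus; auto.
  - apply two_PI_ge_0.
  - intros t _. rewrite Cmult_plus_distr_r, Cexp_plus.
    replace (Cexp (1 * (RtoC t * Ci))) with (cis t) by (unfold cis; f_equal; ring). ring.
Qed.

Lemma CI_one : CI (fun t => Cexp (0 * (RtoC t * Ci))) 0 (2 * PI) = RtoC (2 * PI).
Proof.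
  rewrite (CI_ext _ (fun _ => RtoC 1)).
  - rewrite CI_const, Rminus_0_r. ring.
  - apply two_PI_ge_0.
  - intros t _. rewrite Cmult_0_l. apply Cexp_0.
Qed.

Lemma turn_1 : Cexp (1 * (RtoC (2 * PI) * Ci)) = 1.
Proof. rewrite Cmult_1_l. apply cis_2PI. Qed.

Section CircleIntegrals.
Variables (f : C -> C) (z l : C) (r : R).
Hypotheses (Hr : (0 < r)%R) (Hf : cderivable_on_disc f z r) (Hl : is_cderive f z l).

Lemma circle_mean :
  CI (fun t => f (z + RtoC r * cis t)) 0 (2 * PI) = RtoC (2 * PI) * f z.
Proof.
  rewrite (CI_ext _ (fun t => f (z + RtoC r * cis t) * Cexp (0 * (RtoC t * Ci)))).
  - rewrite (circle_int f z r l 0 Hr Hf Hl); simpl; try lra.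
    + rewrite CI_one, Cplus_0_l, (CI_turn 1).
      * ring.
      * apply turn_1.
      * apply C1_nz.
    + rewrite Cmult_0_l. apply Cexp_0.
  - apply two_PI_ge_0.
  - intros t _. rewrite Cmult_0_l, Cexp_0. ring.
Qed.

Lemma circle_deriv :
  CI (fun t => f (z + RtoC r * cis t) * cis (- t)) 0 (2 * PI) = RtoC (2 * PI) * (RtoC r * l).
Proof.
  rewrite (CI_ext _ (fun t => f (z + RtoC r * cis t) * Cexp (- (1) * (RtoC t * Ci)))).
  - rewrite (circle_int f z r l (- (1)) Hr Hf Hl); simpl; try lra.
    + replace (- (1) + 1) with (RtoC 0) by ring. rewrite CI_one, (CI_turn (- (1))).
      * ring.
      * apply Cexp_2PI_opp, turn_1.
      * exact Cm1_nz.
    + apply Cexp_2PI_opp, turn_1.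
  - apply two_PI_ge_0.
  - intros t _. f_equal. unfold cis. f_equal. rewrite RtoC_opp. ring.
Qed.

Lemma circle_anti :
  CI (fun t => f (z + RtoC r * cis t) * cis t) 0 (2 * PI) = 0.
Proof.
  rewrite (CI_ext _ (fun t => f (z + RtoC r * cis t) * Cexp (1 * (RtoC t * Ci)))).
  - rewrite (circle_int f z r l 1 Hr Hf Hl); simpl; try lra.
    + rewrite (CI_turn 1), (CI_turn (1 + 1)).
      * ring.
      * rewrite Cmult_plus_distr_r, Cexp_plus, turn_1. ring.
      * rewrite <- RtoC_plus. intros E. apply RtoC_inj in E. lra.
      * apply turn_1.
      * apply C1_nz.
    + apply turn_1.
  - apply two_PI_ge_0.
  - intros t _. rewrite Cmult_1_l. reflexivity.
Qed.

Lemma vcont_on_circle_values : vcont_on (fun t => f (z + RtoC r * cis t)) 0 (2 * PI).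
Proof.
  intros t Ht. apply vcont_ext with (fun t => f (z + RtoC r * cis t) * 1); [intros; ring|].
  apply (vcont_on_circle f z r (fun _ => RtoC 1)); auto. intros; apply vcont_const.
Qed.

Lemma Cmod_circle t : Cmod (z + RtoC r * cis t - z) = r.
Proof.
  replace (z + RtoC r * cis t - z) with (RtoC r * cis t) by ring.
  rewrite Cmod_mult, Cmod_cis, Cmod_R, Rabs_right; lra.
Qed.

Lemma mean_value_bound M :
  (forall w, Cmod (w - z) = r -> (Cmod (f w) <= M)%R) -> (Cmod (f z) <= M)%R.
Proof.
  intros HM.
  assert (H : (Cmod (RtoC (2 * PI) * f z) <= M * (2 * PI - 0))%R).
  { rewrite <- circle_mean. apply CI_bound; [apply two_PI_ge_0|apply vcont_on_circle_values|].
    intros t _. apply HM, Cmod_circle. }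
  assert (HP := PI_RGT_0).
  rewrite Cmod_mult, Cmod_R, Rabs_right in H by lra. nra.
Qed.

Lemma circle_deriv_bound M :
  (forall w, Cmod (w - z) = r -> (Cmod (f w) <= M)%R) -> (r * Cmod l <= M)%R.
Proof.
  intros HM.
  assert (H : (Cmod (RtoC (2 * PI) * (RtoC r * l)) <= M * (2 * PI - 0))%R).
  { rewrite <- circle_deriv. apply CI_bound; [apply two_PI_ge_0| |].
    - apply vcont_on_circle; auto. apply vcont_cis_opp.
    - intros t _. rewrite Cmod_mult, Cmod_cis, Rmult_1_r. apply HM, Cmod_circle. }
  assert (HP := PI_RGT_0).
  rewrite !Cmod_mult, !Cmod_R, !Rabs_right in H by lra. nra.
Qed.

(* Since circle_anti removes the conjugate part, l is recovered from the real
   part of f alone; this is the Borel-Caratheodory estimate. *)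
Lemma Borel_Caratheodory A :
  (forall w, Cmod (w - z) = r -> (Re (f w) <= A)%R) -> (r * Cmod l <= 2 * (A - Re (f z)))%R.
Proof.
  intros HA.
  assert (T := two_PI_ge_0). assert (HP := PI_RGT_0).
  assert (Hc := vcont_cis_opp). assert (Hc' := vcont_cis).
  set (g := fun t => f (z + RtoC r * cis t)).
  assert (Hg : vcont_on g 0 (2 * PI)) by apply vcont_on_circle_values.
  assert (Hconj : forall t, Cconj (cis t) = cis (- t)).
  { intros t. unfold cis, Cexp, Cconj; simpl.
    replace (- t * 0 - 0 * 1)%R with 0%R by ring. replace (t * 0 - 0 * 1)%R with 0%R by ring.
    replace (- t * 1 + 0 * 0)%R with (- (t * 1 + 0 * 0))%R by ring.
    rewrite cos_neg, sin_neg. f_equal. ring. }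
  (* The conjugate term integrates to 0, and so does 2 A e^(-it), so h still integrates to 2 pi r l.
     On the other hand h = 2 (Re g - A) e^(-it) has modulus 2 (A - Re g), whose integral the mean
     value property gives exactly. *)
  set (h := fun t => (g t * cis (- t) + Cconj (g t * cis t)) - RtoC (2 * A) * cis (- t)).
  assert (Hh1 : vcont_on (fun t => g t * cis (- t)) 0 (2 * PI))
    by (intros t Ht; apply vcont_mult; auto).
  assert (Hh2 : vcont_on (fun t => g t * cis t) 0 (2 * PI))
    by (intros t Ht; apply vcont_mult; auto).
  assert (Hh3 : vcont_on (fun t => Cconj (g t * cis t)) 0 (2 * PI))
    by (intros t Ht; apply vcont_conj; auto).
  assert (Hh4 : vcont_on (fun t => g t * cis (- t) + Cconj (g t * cis t)) 0 (2 * PI))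
    by (intros t Ht; apply vcont_plus; auto).
  assert (Hh5 : vcont_on (fun t => RtoC (2 * A) * cis (- t)) 0 (2 * PI))
    by (intros t Ht; apply vcont_scal; auto).
  assert (Hh6 : vcont_on (fun t => cis (- t)) 0 (2 * PI)) by (intros t _; auto).
  assert (EC : CI (fun t => cis (- t)) 0 (2 * PI) = 0).
  { rewrite (CI_ext _ (fun t => Cexp (- (1) * (RtoC t * Ci)))); auto.
    - apply CI_turn; [apply Cexp_2PI_opp, turn_1|].
      exact Cm1_nz.
    - intros t _. unfold cis. f_equal. rewrite RtoC_opp. ring. }
  assert (EH : CI h 0 (2 * PI) = RtoC (2 * PI) * (RtoC r * l)).
  { unfold h. rewrite CI_minus, CI_plus, CI_conj, CI_scal, EC by auto.
    unfold g. rewrite circle_deriv, circle_anti.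
    replace (Cconj 0) with (RtoC 0) by (unfold Cconj, RtoC; simpl; f_equal; ring). ring. }
  assert (Eh : forall t, h t = RtoC (2 * (Re (g t) - A)) * cis (- t)).
  { intros t. unfold h. rewrite Cmult_conj, Hconj.
    transitivity ((g t + Cconj (g t) - RtoC (2 * A)) * cis (- t)); [ring|]. f_equal.
    destruct (g t) as [x y]. unfold Cminus, Cconj, RtoC, Cplus, Copp, Re; simpl. f_equal; ring. }
  assert (H : (Cmod (CI h 0 (2 * PI)) <= 2 * (A * (2 * PI) - 2 * PI * Re (f z)))%R).
  { apply (CI_norm_le h (fun t => 2 * (A - Re (g t)))%R); auto.
    - intros t Ht. apply vcont_minus; auto.
    - intros t _. rewrite Eh, Cmod_mult, Cmod_cis, Cmod_R, Rmult_1_r.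
      assert (X := HA _ (Cmod_circle t)). fold (g t) in X.
      rewrite Rabs_left1 by lra. lra.
    - apply (is_RInt_scal (V := R_NormedModule)).
      apply (is_RInt_minus (V := R_NormedModule)).
      + replace (A * (2 * PI))%R with ((2 * PI - 0) * A)%R by ring.
        exact (is_RInt_const (V := R_NormedModule) _ _ A).
      + replace (2 * PI * Re (f z))%R with (Re (CI g 0 (2 * PI))).
        * apply CI_Re; auto.
        * unfold g. rewrite circle_mean. simpl. unfold Re. ring. }
  rewrite EH, !Cmod_mult, !Cmod_R, !Rabs_right in H by lra. nra.
Qed.

End CircleIntegrals.

(** * Entire functions *)

Definition is_derivative (f df : C -> C) : Prop := forall z, is_cderive f z (df z).

Lemma is_derivative_C_derive f : entire f -> is_derivative f (C_derive f).
Proof. intros H z. exact (C_derive_correct f z z (H z)). Qed.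

Lemma is_derivative_unique f df : is_derivative f df -> forall z, C_derive f z = df z.
Proof. intros H z. apply is_C_derive_unique. exact (H z). Qed.

Lemma is_derivative_entire f df : is_derivative f df -> entire f.
Proof. intros H z. exists (df z). exact (H z). Qed.

Lemma is_derivative_disc f df z r : is_derivative f df -> cderivable_on_disc f z r.
Proof. intros H w _. exists (df w). apply H. Qed.

Lemma is_vderive_Re g t l : is_vderive g t l -> is_derive (fun u => Re (g u)) t (Re l).
Proof.
  intros H. apply is_derive_Reals. intros eps He.
  destruct (proj1 (is_vderiveP _ _ _) H (eps / 2)%R ltac:(lra)) as [d [D E]].
  exists (mkposreal d D). intros h Hh0 Hh. simpl in Hh.
  specialize (E (t + h)%R). replace (t + h - t)%R with h in E by ring. specialize (E Hh).
  assert (X := re_le_Cmod (g (t + h)%R - g t - RtoC h * l)).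
  replace (Re (g (t + h)%R - g t - RtoC h * l)) with (Re (g (t + h)%R) - Re (g t) - h * Re l)%R in X
    by (unfold Re; simpl; ring).
  replace ((Re (g (t + h)%R) - Re (g t)) / h - Re l)%R
    with ((Re (g (t + h)%R) - Re (g t) - h * Re l) / h)%R by (field; auto).
  assert (P := Rabs_pos_lt h Hh0).
  unfold Rdiv. rewrite Rabs_mult, Rabs_inv.
  apply Rmult_lt_reg_r with (Rabs h); auto.
  rewrite Rmult_assoc, Rinv_l, Rmult_1_r by lra. nra.
Qed.

Lemma Cmod_sqr_conj u : Cconj u * u = RtoC (Cmod u * Cmod u).
Proof.
  rewrite Cmult_comm, <- Cmod2_conj. f_equal. ring.
Qed.

(** The real mean value theorem is applied to Re (conj u f) along the segment, with u = f b - f a;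
    its increment is |u|^2, and one factor |u| cancels. *)
Lemma mean_value_ineq f df a b M : is_derivative f df ->
  (forall t, (0 <= t <= 1)%R -> (Cmod (df (a + RtoC t * (b - a))%C) <= M)%R) ->
  (Cmod (f b - f a) <= M * Cmod (b - a))%R.
Proof.
  intros Hf HM. set (u := f b - f a). set (q := b - a) in *.
  set (phi := fun t => Re (Cconj u * f (a + RtoC t * q))).
  assert (Hphi : forall t, is_derive phi t (Re (Cconj u * df (a + RtoC t * q) * q))).
  { intros t. apply (is_vderive_Re (fun t => Cconj u * f (a + RtoC t * q))).
    apply (is_vderive_affine (fun w => Cconj u * f w)).
    eapply is_cderive_eq; [apply is_cderive_mult; [apply is_cderive_const|apply Hf]|].
    cbv beta. ring. }
  destruct (MVT_gen phi 0 1 (fun t => Re (Cconj u * df (a + RtoC t * q) * q))) as [t [Ht E]].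
  { intros t _. apply Hphi. }
  { intros t _. apply derivable_continuous_pt.
    eexists. apply is_derive_Reals, Hphi. }
  rewrite Rmin_left, Rmax_right in Ht by lra.
  assert (E1 : (phi 1 - phi 0 = Cmod u * Cmod u)%R).
  { unfold phi. replace (a + RtoC 1 * q) with b by (unfold q; ring).
    replace (a + RtoC 0 * q) with a by (unfold q; ring).
    assert (L : forall c x y, (Re (c * x) - Re (c * y) = Re (c * (x - y)))%R)
      by (intros; unfold Re; simpl; ring).
    rewrite L. fold u. rewrite Cmod_sqr_conj. reflexivity. }
  rewrite E1 in E.
  assert (X := re_le_Cmod (Cconj u * df (a + RtoC t * q) * q)).
  rewrite !Cmod_mult, Cmod_conj in X.
  assert (X2 := Rle_abs (Re (Cconj u * df (a + RtoC t * q) * q))).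
  assert (U := Cmod_ge_0 u). assert (Q := Cmod_ge_0 q).
  assert (HMt := HM t Ht).
  destruct (Rle_lt_or_eq_dec _ _ U) as [U'|U'].
  - apply Rmult_le_reg_l with (Cmod u); auto.
    apply Rle_trans with (Cmod u * Cmod (df (a + RtoC t * q)%C) * Cmod q)%R; [lra|].
    rewrite Rmult_assoc. apply Rmult_le_compat_l; auto. apply Rmult_le_compat_r; auto.
  - rewrite <- U'. assert (D := Cmod_ge_0 (df (a + RtoC t * q))). nra.
Qed.

Lemma derivable_bounded f df r : is_derivative f df ->
  exists M, (0 < M)%R /\ forall z, (Cmod z <= r)%R -> (Cmod (f z) <= M)%R.
Proof.
  intros Hf. destruct (cderivable_bounded f (Rmax 0 r)) as [M [HM H]].
  - intros z _. exists (df z). apply Hf.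
  - apply Rmax_l.
  - exists M. split; auto. intros z Hz. apply H. eapply Rle_trans; [exact Hz|apply Rmax_r].
Qed.

Lemma Cmod_le_add z w r s : (Cmod z <= r)%R -> (Cmod (w - z) <= s)%R -> (Cmod w <= r + s)%R.
Proof.
  intros H1 H2. replace w with (z + (w - z)) by ring.
  eapply Rle_trans; [apply Cmod_triangle|lra].
Qed.

Lemma derivative_bounded f df r : is_derivative f df ->
  exists M, (0 < M)%R /\ forall z, (Cmod z <= r)%R -> (Cmod (df z) <= M)%R.
Proof.
  intros Hf. destruct (derivable_bounded f df (r + 1) Hf) as [M [HM H]].
  exists M. split; auto. intros z Hz.
  rewrite <- (Rmult_1_l (Cmod (df z))).
  apply (circle_deriv_bound f z (df z) 1); try lra; auto.
  - eapply is_derivative_disc; eauto.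
  - intros w Hw. apply H. apply (Cmod_le_add z); lra.
Qed.

(** At this stage [df] is not yet known to be differentiable. Cauchy's estimate is applied instead
    to the difference f(w + h) - f(w), which the mean value inequality bounds by M |h| on the unit
    circle around z. *)
Lemma derivative_Lipschitz f df r : is_derivative f df ->
  exists M, (0 < M)%R /\ forall z h, (Cmod z <= r)%R -> (Cmod h <= 1)%R ->
    (Cmod (df (z + h)%C - df z) <= M * Cmod h)%R.
Proof.
  intros Hf. destruct (derivative_bounded f df (r + 2) Hf) as [M [HM H]].
  exists M. split; auto. intros z h Hz Hh.
  assert (Hd : is_derivative (fun w => f (w + h) - f w) (fun w => df (w + h) - df w)).
  { intros w. apply is_cderive_minus; [|apply Hf].
    eapply is_cderive_eq.
    - apply (is_cderive_comp f (fun w => w + h)); [apply Hf|].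
      apply is_cderive_plus; [apply is_cderive_id|apply is_cderive_const].
    - ring. }
  rewrite <- (Rmult_1_l (Cmod (df (z + h) - df z))).
  apply (circle_deriv_bound _ z _ 1 ltac:(lra) (is_derivative_disc _ _ z 1 Hd) (Hd z)).
  intros w Hw.
  eapply Rle_trans; [apply (mean_value_ineq f df w (w + h) M Hf)|].
  - intros t Ht. apply H. apply Rle_trans with ((r + 1) + 1)%R; [|lra].
    apply (Cmod_le_add w); [apply (Cmod_le_add z); lra|].
    replace (w + RtoC t * (w + h - w) - w) with (RtoC t * h) by ring.
    rewrite Cmod_mult, Cmod_R, Rabs_right by lra. assert (X := Cmod_ge_0 h). nra.
  - right. do 2 f_equal. ring.
Qed.

Lemma Taylor_order2 f df r : is_derivative f df ->
  exists M, (0 < M)%R /\ forall z h, (Cmod z <= r)%R -> (Cmod h <= 1)%R ->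
    (Cmod (f (z + h)%C - f z - df z * h) <= M * Cmod h * Cmod h)%R.
Proof.
  intros Hf. destruct (derivative_Lipschitz f df r Hf) as [M [HM H]].
  exists M. split; auto. intros z h Hz Hh.
  assert (Hd : is_derivative (fun w => f w - df z * w) (fun w => df w - df z)).
  { intros w. apply is_cderive_minus; [apply Hf|].
    apply is_cderive_ext with (fun w => 0 + df z * w); [intros; ring|apply is_cderive_affine]. }
  replace (f (z + h) - f z - df z * h) with ((f (z + h) - df z * (z + h)) - (f z - df z * z)) by ring.
  eapply Rle_trans; [apply (mean_value_ineq _ _ z (z + h) (M * Cmod h) Hd)|].
  - intros t Ht. assert (X := Cmod_ge_0 h).
    replace (z + RtoC t * (z + h - z)) with (z + RtoC t * h) by ring.
    assert (Y : (Cmod (RtoC t * h) <= Cmod h)%R).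
    { rewrite Cmod_mult, Cmod_R, Rabs_right by lra. nra. }
    eapply Rle_trans; [apply H; auto; lra|]. apply Rmult_le_compat_l; lra.
  - right. do 2 f_equal. ring.
Qed.

Lemma quadratic_is_cderive f z l M : (0 < M)%R ->
  (forall h, (Cmod h <= 1)%R -> (Cmod (f (z + h)%C - f z - l * h) <= M * Cmod h * Cmod h)%R) ->
  is_cderive f z l.
Proof.
  intros HM H. apply is_cderiveP. intros eps He.
  exists (Rmin 1 (eps / M)). split; [apply Rmin_pos; [lra|apply Rdiv_lt_0_compat; auto]|].
  intros w Hw.
  assert (H1 := Rlt_le_trans _ _ _ Hw (Rmin_l _ _)).
  assert (H2 := Rlt_le_trans _ _ _ Hw (Rmin_r _ _)).
  specialize (H (w - z) ltac:(lra)). replace (z + (w - z)) with w in H by ring.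
  eapply Rle_trans; [exact H|]. apply Rmult_le_compat_r; [apply Cmod_ge_0|].
  apply Rmult_le_reg_r with (/ M)%R; [apply Rinv_0_lt_compat; auto|].
  replace (M * Cmod (w - z) * / M)%R with (Cmod (w - z)) by (field; lra).
  unfold Rdiv in H2. lra.
Qed.

Lemma derivative_continuous f df z : is_derivative f df ->
  forall g t, vcont g t -> g t = z -> vcont (fun u => df (g u)) t.
Proof.
  intros Hf g t Hg E. apply vcontP. intros eps He.
  destruct (derivative_Lipschitz f df (Cmod z) Hf) as [M [HM H]].
  assert (Hk : (0 < Rmin 1 (eps / M))%R) by (apply Rmin_pos; [lra|apply Rdiv_lt_0_compat; auto]).
  destruct (proj1 (vcontP _ _) Hg _ Hk) as [d [D K]].
  exists d. split; auto. intros u Hu. specialize (K u Hu).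
  assert (K1 := Rle_trans _ _ _ K (Rmin_l _ _)).
  assert (K2 := Rle_trans _ _ _ K (Rmin_r _ _)).
  specialize (H (g t) (g u - g t)). rewrite E in H at 1. specialize (H (Rle_refl _) K1).
  replace (g t + (g u - g t)) with (g u) in H by ring.
  eapply Rle_trans; [exact H|].
  replace eps with (M * (eps / M))%R by (field; lra).
  apply Rmult_le_compat_l; lra.
Qed.

(** Differentiation under the integral sign in Cauchy's formula for [df]: the quadratic Taylor
    remainder of [f] is uniform over the unit circle, so its integral is again quadratic in h. *)
Lemma derivative_derivable f df : is_derivative f df -> exists ddf, is_derivative df ddf.
Proof.
  intros Hf.
  exists (fun z => / RtoC (2 * PI) * CI (fun t => df (z + cis t) * cis (- t)) 0 (2 * PI)).
  intros z.
  destruct (Taylor_order2 f df (Cmod z + 1) Hf) as [M [HM H]].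
  assert (HP := PI_RGT_0). assert (T := two_PI_ge_0).
  apply (quadratic_is_cderive _ _ _ M HM). intros h Hh.
  assert (HD : forall z r, cderivable_on_disc f z r)
    by (intros; eapply is_derivative_disc; eauto).
  assert (HC : forall w, RtoC (2 * PI) * df w = CI (fun t => f (w + cis t) * cis (- t)) 0 (2 * PI)).
  { intros w. transitivity (RtoC (2 * PI) * (RtoC 1 * df w)); [ring|].
    rewrite <- (circle_deriv f w (df w) 1 ltac:(lra) (HD _ _) (Hf w)).
    apply CI_ext; auto. intros t _. do 2 f_equal. ring. }
  assert (HV : forall w, vcont_on (fun t => f (w + cis t) * cis (- t)) 0 (2 * PI)).
  { intros w t Ht. apply (vcont_mult (fun t => f (w + cis t)) (fun t => cis (- t)));
      [|apply vcont_cis_opp].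
    apply (vcont_comp f (fun t => w + cis t) t _ (Hf _)).
    apply vcont_plus; [apply vcont_const|apply vcont_cis]. }
  assert (HV2 : vcont_on (fun t => df (z + cis t) * cis (- t)) 0 (2 * PI)).
  { intros t Ht. apply (vcont_mult (fun t => df (z + cis t)) (fun t => cis (- t)));
      [|apply vcont_cis_opp].
    apply (derivative_continuous f df (z + cis t) Hf (fun t => z + cis t)); auto.
    apply vcont_plus; [apply vcont_const|apply vcont_cis]. }
  assert (HV3 : vcont_on (fun t => f ((z + h) + cis t) * cis (- t) - f (z + cis t) * cis (- t)) 0 (2 * PI))
    by (intros t Ht; apply vcont_minus; [apply HV|apply HV]; auto).
  assert (HV4 : vcont_on (fun t => h * (df (z + cis t) * cis (- t))) 0 (2 * PI))
    by (intros t Ht; apply vcont_scal; auto).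
  assert (N : RtoC (2 * PI) <> 0) by (intros E; apply RtoC_inj in E; lra).
  set (J := CI (fun t => df (z + cis t) * cis (- t)) 0 (2 * PI)).
  assert (E : RtoC (2 * PI) * (df (z + h) - df z - / RtoC (2 * PI) * J * h) =
    CI (fun t => f ((z + h) + cis t) * cis (- t) - f (z + cis t) * cis (- t)
                 - h * (df (z + cis t) * cis (- t))) 0 (2 * PI)).
  { rewrite CI_minus, CI_minus, CI_scal, <- !HC by auto. fold J. field. auto. }
  apply Rmult_le_reg_l with (2 * PI)%R; [lra|].
  replace (2 * PI)%R with (Cmod (RtoC (2 * PI))) at 1 by (rewrite Cmod_R, Rabs_right; lra).
  rewrite <- Cmod_mult, E.
  replace (2 * PI * (M * Cmod h * Cmod h))%R with (M * Cmod h * Cmod h * (2 * PI - 0))%R by ring.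
  apply CI_bound; auto.
  - intros t Ht. apply vcont_minus; auto.
  - intros t Ht.
    replace (f (z + h + cis t) * cis (- t) - f (z + cis t) * cis (- t) -
       h * (df (z + cis t) * cis (- t))) with
     ((f (z + cis t + h) - f (z + cis t) - df (z + cis t) * h) * cis (- t))
     by (replace (z + h + cis t) with (z + cis t + h) by ring; ring).
    rewrite Cmod_mult, Cmod_cis, Rmult_1_r. apply H; auto.
    eapply Rle_trans; [apply Cmod_triangle|]. rewrite Cmod_cis. lra.
Qed.

(** For each s the integrand h(s (z + k)) (z + k) is expanded to first order in k. The linear term
    is k times a total derivative in s and integrates to h(z) k; the rest is quadratic in k. *)
Lemma Cint_derivative h dh : is_derivative h dh -> is_derivative (Cint h 0) h.
Proof.
  intros Hh z.
  assert (I01 : (0 <= 1)%R) by lra.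
  destruct (Taylor_order2 h dh (Cmod z) Hh) as [M [HM H]].
  destruct (derivative_bounded h dh (Cmod z) Hh) as [M' [HM' H']].
  assert (Z := Cmod_ge_0 z).
  apply (quadratic_is_cderive _ _ _ ((Cmod z + 1) * M + M')); [nra|].
  intros k Hk.
  assert (EC : forall w, Cint h 0 w = CI (fun s => h (RtoC s * w) * w) 0 1).
  { intros w. unfold Cint. apply CI_ext; auto. intros s _.
    replace (w - 0) with w by ring. rewrite Cplus_0_l. reflexivity. }
  assert (Hv : forall w t, vcont (fun s => RtoC s * w) t).
  { intros w t. apply vcont_ext with (fun s => 0 + RtoC s * w); [intros; ring|apply vcont_affine]. }
  assert (V1 : forall w, vcont_on (fun s => h (RtoC s * w) * w) 0 1).
  { intros w t _. apply (vcont_mult (fun s => h (RtoC s * w)) (fun _ => w)); [|apply vcont_const].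
    apply (vcont_comp h (fun s => RtoC s * w) t _ (Hh _)). apply Hv. }
  assert (V2 : forall t, vcont (fun s => dh (RtoC s * z)) t).
  { intros t. apply (derivative_continuous h dh (RtoC t * z) Hh (fun s => RtoC s * z)); auto. }
  assert (V3 : vcont_on (fun s => h (RtoC s * z) + RtoC s * z * dh (RtoC s * z)) 0 1).
  { intros t _. apply vcont_plus.
    - apply (vcont_comp h (fun s => RtoC s * z) t _ (Hh _)). apply Hv.
    - apply (vcont_mult (fun s => RtoC s * z) (fun s => dh (RtoC s * z))); auto. }
  (* h z is the integral over [0,1] of d/ds (s h(s z)). *)
  assert (EF : CI (fun s => h (RtoC s * z) + RtoC s * z * dh (RtoC s * z)) 0 1 = h z).
  { rewrite (CI_ext _ (fun s => (fun w => h (w * z) + w * z * dh (w * z)) (0 + RtoC s * 1) * 1)); auto.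
    - etransitivity; [apply (CI_FTC (fun w => w * h (w * z)) (fun w => h (w * z) + w * z * dh (w * z)) 0 1); auto|].
      + intros t _. eapply is_cderive_eq.
        * apply (is_cderive_mult (fun w => w) (fun w => h (w * z))); [apply is_cderive_id|].
          apply (is_cderive_comp h (fun w => w * z)); [apply Hh|].
          apply is_cderive_mult; [apply is_cderive_id|apply is_cderive_const].
        * cbv beta. ring.
      + intros t Ht. apply vcont_ext with (fun s => h (RtoC s * z) + RtoC s * z * dh (RtoC s * z)); auto.
        intros u. replace (0 + RtoC u * 1) with (RtoC u) by ring. reflexivity.
      + replace (0 + RtoC 1 * 1) with (RtoC 1) by ring.
        replace (0 + RtoC 0 * 1) with (RtoC 0) by ring. rewrite !Cmult_1_l. ring.
    - intros t _. cbv beta. replace (0 + RtoC t * 1) with (RtoC t) by ring. ring. }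
  (* Exact remainder of the expansion: z + k times the Taylor remainder of [h], plus the k^2 term
     produced by the factor z + k. *)
  set (e := fun s => (z + k) * (h (RtoC s * z + RtoC s * k) - h (RtoC s * z) - dh (RtoC s * z) * (RtoC s * k))
     + RtoC s * (k * k) * dh (RtoC s * z)).
  assert (V4 : vcont_on (fun s => k * (h (RtoC s * z) + RtoC s * z * dh (RtoC s * z))) 0 1)
    by (intros t Ht; apply vcont_scal; auto).
  assert (V5 : vcont_on (fun s => h (RtoC s * (z + k)) * (z + k) - h (RtoC s * z) * z) 0 1).
  { intros t Ht. apply vcont_minus; apply V1; auto. }
  assert (Ee : forall s, h (RtoC s * (z + k)) * (z + k) - h (RtoC s * z) * z
     - k * (h (RtoC s * z) + RtoC s * z * dh (RtoC s * z)) = e s).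
  { intros s. unfold e. replace (RtoC s * (z + k)) with (RtoC s * z + RtoC s * k) by ring. ring. }
  assert (E : Cint h 0 (z + k) - Cint h 0 z - h z * k = CI e 0 1).
  { rewrite <- (CI_ext _ e 0 1 I01 (fun s _ => Ee s)).
    rewrite CI_minus, CI_minus, CI_scal by auto. rewrite EF, !EC. ring. }
  rewrite E.
  replace (((Cmod z + 1) * M + M') * Cmod k * Cmod k)%R with
   (((Cmod z + 1) * (M * Cmod k * Cmod k) + M' * Cmod k * Cmod k) * (1 - 0))%R by ring.
  apply CI_bound; auto.
  - intros t Ht. apply vcont_ext with (1 := Ee).
    apply vcont_minus; auto.
  - intros s Hs. unfold e.
    assert (K := Cmod_ge_0 k).
    assert (S1 : (Cmod (RtoC s * z) <= Cmod z)%R).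
    { rewrite Cmod_mult, Cmod_R, Rabs_right by lra. nra. }
    assert (S2 : (Cmod (RtoC s * k) <= Cmod k)%R).
    { rewrite Cmod_mult, Cmod_R, Rabs_right by lra. nra. }
    assert (X := H (RtoC s * z) (RtoC s * k) S1 ltac:(lra)).
    assert (Y := H' (RtoC s * z) S1).
    assert (S3 := Cmod_ge_0 (RtoC s * k)).
    eapply Rle_trans; [apply Cmod_triangle|].
    apply Rplus_le_compat.
    + rewrite Cmod_mult. apply Rmult_le_compat; try apply Cmod_ge_0.
      * eapply Rle_trans; [apply Cmod_triangle|]. lra.
      * eapply Rle_trans; [exact X|].
        apply Rmult_le_compat; auto; [nra|]. apply Rmult_le_compat_l; lra.
    + rewrite !Cmod_mult, Cmod_R, Rabs_right by lra.
      assert (Y0 := Cmod_ge_0 (dh (RtoC s * z))).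
      replace (M' * Cmod k * Cmod k)%R with (1 * (Cmod k * Cmod k) * M')%R by ring.
      apply Rmult_le_compat; auto; [nra|]. apply Rmult_le_compat_r; nra.
Qed.

(** * Logarithms and zero-free functions of polynomial growth *)

Lemma derivative_zero_constant f : is_derivative f (fun _ => 0) -> forall z, f z = f 0.
Proof.
  intros Hf z.
  assert (H := mean_value_ineq f (fun _ => 0) 0 z 0 Hf).
  apply Cminus_eq_0_uniq, Cmod_eq_0, Rle_antisym; [|apply Cmod_ge_0].
  rewrite Rmult_0_l in H. apply H. intros. rewrite Cmod_0. lra.
Qed.

Lemma Cint_point h : Cint h 0 0 = 0.
Proof.
  unfold Cint. change (CI (fun s => h (0 + RtoC s * (0 - 0)) * (0 - 0)) 0 1 = 0).
  rewrite (CI_ext _ (fun _ => RtoC 0)); [|lra|intros; ring]. rewrite CI_const. ring.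
Qed.

(** With h the integral of F'/F from 0, the product F e^(-h) has derivative 0, and F(0) = 1 makes
    its constant value 1. *)
Lemma entire_log F dF : is_derivative F dF -> (forall z, F z <> 0) -> F 0 = 1 ->
  exists h, is_derivative h (fun z => dF z / F z) /\ forall z, F z = Cexp (h z).
Proof.
  intros HF HN H1. destruct (derivative_derivable F dF HF) as [ddF HdF].
  set (q := fun z => dF z / F z).
  assert (Hq : is_derivative q (fun z => (ddF z * F z - dF z * dF z) / (F z * F z)))
    by (intros z; apply is_cderive_div; auto).
  set (h := Cint q 0).
  assert (Hh : is_derivative h q) by exact (Cint_derivative q _ Hq).
  exists h. split; [exact Hh|].
  assert (HG : is_derivative (fun z => F z * Cexp (- h z)) (fun _ => 0)).
  { intros z. eapply is_cderive_eq.
    - apply is_cderive_mult; [apply HF|].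
      apply (is_cderive_comp Cexp (fun z => - h z)); [apply is_cderive_Cexp|].
      apply is_cderive_opp, Hh.
    - cbv beta. unfold q. field. auto. }
  intros z. assert (E := derivative_zero_constant _ HG z). cbv beta in E.
  unfold h in E at 2. rewrite H1, Cint_point, Copp_0, Cexp_0, Cexp_opp in E.
  rewrite <- (Cmult_1_l (Cexp (h z))). rewrite <- (Cmult_1_l 1), <- E.
  field. apply Cexp_neq_0.
Qed.

(** This is 1 + x <= exp x at x = ln (e y), with the 1 dropped. The free slope [e] lets a logarithm
    lose against any given linear term. *)
Lemma ln_le_linear (e y : R) : (0 < e)%R -> (0 < y)%R -> (ln y <= e * y - ln e)%R.
Proof.
  intros He Hy. assert (H := exp_ineq1_le (ln (e * y))).
  assert (P : (0 < e * y)%R) by (apply Rmult_lt_0_compat; auto).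
  rewrite exp_ln, ln_mult in H by auto. lra.
Qed.

(* F = e^h with Re h = O(log |z|), so Borel-Caratheodory on large circles gives h' = 0. *)
Lemma zero_free_polynomial_growth F dF (A : R) (m : nat) :
  is_derivative F dF -> (forall z, F z <> 0) -> F 0 = 1 -> (0 < A)%R ->
  (forall z, (Cmod (F z) <= A * (1 + Cmod z) ^ m)%R) -> forall z, dF z = 0.
Proof.
  intros HF HN H1 HA HB z.
  destruct (entire_log F dF HF HN H1) as [h [Hh HE]].
  set (l := dF z / F z).
  assert (Hln : forall w, (Re (h w) <= ln A + INR m * ln (1 + Cmod w))%R).
  { intros w. assert (W := Cmod_ge_0 w).
    rewrite <- (ln_exp (Re (h w))), <- Cmod_Cexp, <- HE.
    assert (P : (0 < Cmod (F w))%R) by (apply Cmod_gt_0; auto).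
    assert (Q : (0 < (1 + Cmod w) ^ m)%R) by (apply pow_lt; lra).
    rewrite <- (ln_pow (1 + Cmod w)) by lra. rewrite <- ln_mult by auto.
    destruct (HB w) as [L|L]; [left; apply ln_increasing; auto|right; f_equal; auto]. }
  assert (Hr : forall r, (0 < r)%R ->
     (r * Cmod l <= 2 * (ln A + INR m * ln (1 + Cmod z + r) - Re (h z)))%R).
  { intros r Hr. apply (Borel_Caratheodory h z l r Hr (is_derivative_disc _ _ z r Hh) (Hh z)).
    intros w Hw. eapply Rle_trans; [apply Hln|].
    apply Rplus_le_compat_l, Rmult_le_compat_l; [apply pos_INR|].
    assert (T := Cmod_le_add z w (Cmod z) r (Rle_refl _) (Req_le _ _ Hw)).
    assert (W := Cmod_ge_0 w).
    destruct (Rle_lt_or_eq_dec (1 + Cmod w) (1 + Cmod z + r) ltac:(lra)) as [T'|T'].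
    - left; apply ln_increasing; lra.
    - right; f_equal; auto. }
  destruct (Req_dec (Cmod l) 0) as [E|E].
  - apply Cmod_eq_0 in E. unfold l in E.
    transitivity (dF z / F z * F z); [field; auto|]. rewrite E. ring.
  - exfalso. set (c := Cmod l) in *.
    assert (Hc : (0 < c)%R) by (assert (X := Cmod_ge_0 l); fold c in X; lra).
    assert (M := pos_INR m). set (n := INR m) in *.
    (* With this slope 2 n e <= c / 2, so the logarithm absorbs at most half of r c, and r (c / 2)
       would stay bounded for all r. *)
    set (e := (c / (4 * (n + 1)))%R).
    assert (He : (0 < e)%R) by (apply Rdiv_lt_0_compat; lra).
    set (B := (2 * (ln A + n * (e * (1 + Cmod z) - ln e) - Re (h z)))%R).
    assert (HB2 : forall r, (0 < r)%R -> (r * (c / 2) <= B)%R).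
    { intros r Hr0. specialize (Hr r Hr0). assert (Z := Cmod_ge_0 z).
      assert (X := ln_le_linear e (1 + Cmod z + r) He ltac:(lra)).
      assert (Y : (n * ln (1 + Cmod z + r) <= n * (e * (1 + Cmod z + r) - ln e))%R)
        by (apply Rmult_le_compat_l; auto).
      assert (K : (2 * (n * e) <= c / 2)%R).
      { replace (c / 2)%R with (2 * ((n + 1) * e))%R by (unfold e; field; lra). nra. }
      unfold B. nra. }
    assert (W := HB2 ((Rabs B + 1) / (c / 2))%R).
    assert (AB := Rle_abs B). assert (AB' := Rabs_pos B).
    replace ((Rabs B + 1) / (c / 2) * (c / 2))%R with (Rabs B + 1)%R in W by (field; lra).
    assert ((0 < (Rabs B + 1) / (c / 2))%R) by (apply Rdiv_lt_0_compat; lra). specialize (W H). lra.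
Qed.

Lemma AutC_of_derivative f : is_derivative f (fun _ => 1) -> AutC f.
Proof.
  intros Hf. exists (f 0). intros z.
  assert (H : is_derivative (fun w => f w - w) (fun _ => 0)).
  { intros w. eapply is_cderive_eq; [apply is_cderive_minus; [apply Hf|apply is_cderive_id]|ring]. }
  assert (E := derivative_zero_constant _ H z). cbv beta in E.
  transitivity (f z - z + z); [ring|]. rewrite E. ring.
Qed.

Lemma elh_second_derivative_zero f df : is_derivative f df -> df 0 = 1 ->
  is_derivative df (fun _ => 0) -> AutC f.
Proof.
  intros Hf H1 Hdf. apply AutC_of_derivative. intros z.
  rewrite <- H1, <- (derivative_zero_constant df Hdf z). apply Hf.
Qed.

(** Cauchy's estimate on unit circles passes the growth from [L] to [dL], with 2^m coming from 2 +
    |z| <= 2 (1 + |z|); as [dL] has no zeros, it is constant. *)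
Lemma elh_polynomial_growth L dL (A : R) (m : nat) : is_derivative L dL ->
  (forall z, dL z <> 0) -> dL 0 = 1 -> (0 < A)%R ->
  (forall z, (Cmod (L z) <= A * (1 + Cmod z) ^ m)%R) -> AutC L.
Proof.
  intros HL HN H1 HA HB. destruct (derivative_derivable L dL HL) as [ddL HdL].
  apply (elh_second_derivative_zero L dL HL H1).
  assert (E : forall z, ddL z = 0).
  { apply (zero_free_polynomial_growth dL ddL (A * 2 ^ m) m HdL HN H1).
    - apply Rmult_lt_0_compat; auto. apply pow_lt; lra.
    - intros z. rewrite <- (Rmult_1_l (Cmod (dL z))).
      apply (circle_deriv_bound L z (dL z) 1 ltac:(lra) (is_derivative_disc _ _ z 1 HL) (HL z)).
      intros w Hw. eapply Rle_trans; [apply HB|].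
      rewrite Rmult_assoc, <- Rpow_mult_distr. apply Rmult_le_compat_l; [lra|].
      apply pow_incr.
      assert (T := Cmod_le_add z w (Cmod z) 1 (Rle_refl _) (Req_le _ _ Hw)).
      assert (W := Cmod_ge_0 w). assert (Z := Cmod_ge_0 z). lra. }
  intros z. eapply is_cderive_eq; [apply HdL|apply E].
Qed.

(** * Exponential behaviour near points of almost maximal modulus *)

Lemma weighted_derive (r : R -> R) (s l c R0 : R) : is_derive r s l ->
  is_derive (fun s => (c - r s) * (R0 - s) ^ 2)%R s
    (- l * (R0 - s) ^ 2 - 2 * (c - r s) * (R0 - s))%R.
Proof.
  intros Hr. auto_derive; [exists l; exact Hr|].
  change (Derive (fun x => r x) s) with (Derive r s).
  rewrite (is_derive_unique r s l Hr). ring.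
Qed.

(* With v = 1 + eps - Re G >= 0, Borel-Caratheodory on the largest admissible
   circle gives |v'| <= 2 v / (R - t) along rays, so v (R - t)^2 decreases. *)
Lemma near_constant G dG (eps R : R) : is_derivative G dG -> G 0 = 1 -> (0 < R)%R ->
  (forall x, (Cmod x <= R)%R -> (Re (G x) <= 1 + eps)%R) ->
  forall x, (Cmod x <= R / 2)%R ->
    (Cmod (dG x) <= 16 * eps / R)%R /\ (Cmod (G x - 1) <= 8 * eps)%R.
Proof.
  intros HG G0 HR HB.
  assert (HBC : forall x, (Cmod x < R)%R ->
    ((R - Cmod x) * Cmod (dG x) <= 2 * (1 + eps - Re (G x)))%R).
  { intros x Hx. apply (Borel_Caratheodory G x (dG x) (R - Cmod x) ltac:(lra)
      (is_derivative_disc _ _ _ _ HG) (HG x)).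
    intros w Hw. apply HB.
    assert (T := Cmod_le_add x w (Cmod x) (R - Cmod x) (Rle_refl _) (Req_le _ _ Hw)). lra. }
  assert (Heps : (0 <= eps)%R).
  { specialize (HB 0). rewrite Cmod_0, G0 in HB. simpl in HB. specialize (HB ltac:(lra)). lra. }
  assert (Hray : forall u t, Cmod u = 1%R -> (0 <= t < R)%R ->
    ((1 + eps - Re (G (RtoC t * u)%C)) * (R - t) ^ 2 <= eps * R ^ 2)%R).
  { intros u t Hu Ht.
    set (v := fun s => ((1 + eps - Re (G (0 + RtoC s * u)%C)) * (R - s) ^ 2)%R).
    set (dv := fun s => (- Re (dG (0 + RtoC s * u)%C * u)%C * (R - s) ^ 2
         - 2 * (1 + eps - Re (G (0 + RtoC s * u)%C)) * (R - s))%R).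
    assert (Hv : forall s, is_derive v s (dv s)).
    { intros s.
      assert (D1 : is_derive (fun s => Re (G (0 + RtoC s * u))) s (Re (dG (0 + RtoC s * u) * u)))
        by (apply (is_vderive_Re (fun s => G (0 + RtoC s * u))), is_vderive_affine, HG).
      exact (weighted_derive _ s _ (1 + eps) R D1). }
    destruct (MVT_gen v 0 t dv) as [s [Hs E]].
    { intros s _. apply Hv. }
    { intros s _. apply derivable_continuous_pt. exists (dv s). apply is_derive_Reals, Hv. }
    rewrite Rmin_left, Rmax_right in Hs by lra.
    assert (Hds : (dv s <= 0)%R).
    { assert (Hm : Cmod (0 + RtoC s * u) = s).
      { rewrite Cplus_0_l, Cmod_mult, Cmod_R, Hu, Rabs_right; lra. }
      assert (X := HBC (0 + RtoC s * u)). rewrite Hm in X. specialize (X ltac:(lra)).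
      assert (Y := re_le_Cmod (dG (0 + RtoC s * u) * u)).
      rewrite Cmod_mult, Hu, Rmult_1_r in Y.
      assert (Z := Rle_abs (- Re (dG (0 + RtoC s * u) * u))). rewrite Rabs_Ropp in Z.
      unfold dv. set (p := Re (dG (0 + RtoC s * u) * u)) in *.
      set (q := Cmod (dG (0 + RtoC s * u))) in *. set (g := Re (G (0 + RtoC s * u))) in *.
      assert (K : (- p * (R - s) <= 2 * (1 + eps - g))%R) by nra.
      replace (- p * (R - s) ^ 2 - 2 * (1 + eps - g) * (R - s))%R with
        ((- p * (R - s) - 2 * (1 + eps - g)) * (R - s))%R by ring.
      nra. }
    assert (E0 : v 0%R = (eps * R ^ 2)%R).
    { unfold v. replace (0 + RtoC 0 * u) with (RtoC 0) by ring. rewrite G0. simpl. ring. }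
    assert (Et : v t = ((1 + eps - Re (G (RtoC t * u)%C)) * (R - t) ^ 2)%R).
    { unfold v. rewrite Cplus_0_l. reflexivity. }
    rewrite <- Et, <- E0. nra. }
  (* For |x| <= R / 2 the weight (R - |x|)^2 is at least R^2 / 4, which bounds v by 4 eps; the
     derivative bound then follows with a radius of at least R / 2. *)
  assert (Hdisc : forall x, (Cmod x <= R / 2)%R -> (1 + eps - Re (G x) <= 4 * eps)%R).
  { intros x Hx. destruct (Ceq_dec x 0) as [->|Nx].
    - rewrite G0. simpl. lra.
    - assert (Px : (0 < Cmod x)%R) by (apply Cmod_gt_0; auto).
      assert (N : RtoC (Cmod x) <> 0) by (intros E; apply RtoC_inj in E; lra).
      assert (X := Hray (x / RtoC (Cmod x)) (Cmod x)).
      rewrite Cmod_div, Cmod_R, Rabs_right in X by (auto; lra).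
      replace (RtoC (Cmod x) * (x / RtoC (Cmod x))) with x in X by (field; auto).
      assert (E1 : (Cmod x / Cmod x = 1)%R) by (field; lra).
      specialize (X E1 ltac:(lra)).
      assert (Y := HB x ltac:(lra)).
      assert (Q : (R ^ 2 / 4 <= (R - Cmod x) ^ 2)%R) by (simpl; nra).
      assert (P2 : (0 < R ^ 2)%R) by (simpl; nra).
      set (v := (1 + eps - Re (G x))%R) in *.
      assert (V : (0 <= v)%R) by (unfold v; lra).
      assert (W : (v * (R ^ 2 / 4) <= eps * R ^ 2)%R).
      { eapply Rle_trans; [|exact X]. apply Rmult_le_compat_l; auto. }
      apply Rmult_le_reg_r with (R ^ 2)%R; auto. lra. }
  assert (HdG : forall x, (Cmod x <= R / 2)%R -> (Cmod (dG x) <= 16 * eps / R)%R).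
  { intros x Hx. assert (X := HBC x ltac:(lra)). assert (Y := Hdisc x Hx).
    assert (D := Cmod_ge_0 (dG x)).
    apply Rmult_le_reg_r with (R / 2)%R; [lra|].
    replace (16 * eps / R * (R / 2))%R with (8 * eps)%R by (field; lra). nra. }
  intros x Hx. split; [apply HdG; auto|].
  rewrite <- G0.
  eapply Rle_trans; [apply (mean_value_ineq G dG 0 x (16 * eps / R) HG)|].
  - intros t Ht. apply HdG. replace (0 + RtoC t * (x - 0)) with (RtoC t * x) by ring.
    rewrite Cmod_mult, Cmod_R, Rabs_right by lra. assert (X := Cmod_ge_0 x). nra.
  - replace (x - 0) with x by ring.
    replace (8 * eps)%R with (16 * eps / R * (R / 2))%R by (field; lra).
    apply Rmult_le_compat_l; auto.
    apply Rmult_le_pos; [lra|]. left; apply Rinv_0_lt_compat; auto.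
Qed.

Lemma exp_quarter : (exp (1 / 4) <= 2)%R.
Proof.
  assert (H : (exp (1 / 4) * exp (3 / 4) <= 3)%R).
  { rewrite <- exp_plus. replace (1 / 4 + 3 / 4)%R with 1%R by field. apply exp_le_3. }
  assert (H2 := exp_ineq1_le (3 / 4)). assert (H3 := exp_pos (1 / 4)). nra.
Qed.

Lemma exp_le_compat (x y : R) : (x <= y)%R -> (exp x <= exp y)%R.
Proof. intros [H|H]; [left; apply exp_increasing; auto|right; f_equal; auto]. Qed.

(** The mean value inequality, used twice, gives |e^w - 1| <= 2 |w| <= 1/2 on the disc and then |e^u
    - 1 - u| <= |u| / 2, so |e^u - 1| is at least |u| / 2 = 1/8. *)
Lemma Cexp_quarter_lower u : Cmod u = (1 / 4)%R ->
  (Cmod (Cexp u) <= 2)%R /\ (1 / 8 <= Cmod (Cexp u - 1))%R.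
Proof.
  intros Hu.
  assert (Hb : forall w, (Cmod w <= 1 / 4)%R -> (Cmod (Cexp w) <= 2)%R).
  { intros w Hw. rewrite Cmod_Cexp. eapply Rle_trans; [|apply exp_quarter].
    apply exp_le_compat. assert (X := re_le_Cmod w). assert (Y := Rle_abs (Re w)). lra. }
  assert (Hseg : forall w t, (Cmod w <= 1 / 4)%R -> (0 <= t <= 1)%R ->
      (Cmod (0 + RtoC t * (w - 0)) <= Cmod w)%R).
  { intros w t Hw Ht. replace (0 + RtoC t * (w - 0)) with (RtoC t * w) by ring.
    rewrite Cmod_mult, Cmod_R, Rabs_right by lra. assert (X := Cmod_ge_0 w). nra. }
  assert (H1 : forall w, (Cmod w <= 1 / 4)%R -> (Cmod (Cexp w - 1) <= 2 * Cmod w)%R).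
  { intros w Hw. rewrite <- Cexp_0 at 1.
    eapply Rle_trans; [apply (mean_value_ineq Cexp Cexp 0 w 2 is_cderive_Cexp)|].
    - intros t Ht. apply Hb. assert (X := Hseg w t Hw Ht). lra.
    - replace (w - 0) with w by ring. lra. }
  assert (Hd : is_derivative (fun w => Cexp w - w) (fun w => Cexp w - 1))
    by (intros w; apply is_cderive_minus; [apply is_cderive_Cexp|apply is_cderive_id]).
  assert (H2 := mean_value_ineq _ _ 0 u (1 / 2) Hd). cbv beta in H2.
  rewrite Cexp_0 in H2.
  assert (H3 : (Cmod (Cexp u - u - (1 - 0)) <= 1 / 2 * Cmod (u - 0))%R).
  { apply H2. intros t Ht. assert (X := Hseg u t ltac:(lra) Ht).
    eapply Rle_trans; [apply H1|]; lra. }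
  replace (u - 0) with u in H3 by ring. rewrite Hu in H3.
  split; [apply Hb; lra|].
  assert (T := Cmod_triangle (Cexp u - 1) (- (Cexp u - u - (1 - 0)))).
  replace (Cexp u - 1 + - (Cexp u - u - (1 - 0))) with u in T by ring.
  rewrite Cmod_opp, Hu in T. lra.
Qed.

(* Rouche's theorem is avoided: if e^x G(x) missed the value e^{i phi} near x = i phi, then 1/(e^x G(x) - e^{i phi})
   would be larger at the centre of a disc than on its boundary. *)
Lemma covers_unit_circle G dG (eps phi : R) : is_derivative G dG -> (0 < eps < 1 / 200)%R ->
  (forall x, (Cmod x <= 6)%R -> (Cmod (G x - 1) <= 8 * eps)%R) -> (-4 <= phi <= 4)%R ->
  exists x, (Cmod x <= 5)%R /\ Cexp x * G x = cis phi.
Proof.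
  intros HG Heps HB Hphi. apply NNPP. intros HN.
  set (x0 := RtoC phi * Ci).
  assert (Hx0 : (Cmod x0 <= 4)%R).
  { unfold x0. rewrite Cmod_mult, Cmod_Ci, Cmod_R, Rmult_1_r. apply Rabs_le. lra. }
  assert (Hin : forall w, (Cmod (w - x0) <= 1 / 4)%R -> (Cmod w <= 5)%R).
  { intros w Hw. assert (T := Cmod_le_add x0 w 4 (1 / 4) Hx0 Hw). lra. }
  set (E := fun x => Cexp x * G x - cis phi).
  assert (HE : is_derivative E (fun x => Cexp x * G x + Cexp x * dG x - 0)).
  { intros x. apply is_cderive_minus; [|apply is_cderive_const].
    apply is_cderive_mult; [apply is_cderive_Cexp|apply HG]. }
  assert (HE0 : forall w, (Cmod (w - x0) <= 1 / 4)%R -> E w <> 0).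
  { intros w Hw E0. apply HN. exists w. split; [apply Hin; auto|].
    apply Cminus_eq_0_uniq. exact E0. }
  assert (Hc : E x0 = cis phi * (G x0 - 1)).
  { unfold E. change (Cexp x0) with (cis phi). ring. }
  assert (Hcm : (Cmod (E x0) <= 8 * eps)%R).
  { rewrite Hc, Cmod_mult, Cmod_cis, Rmult_1_l. apply HB. lra. }
  assert (Hcirc : forall w, Cmod (w - x0) = (1 / 4)%R -> (1 / 8 - 16 * eps <= Cmod (E w))%R).
  { intros w Hw. set (u := w - x0) in *.
    destruct (Cexp_quarter_lower u Hw) as [U1 U2].
    assert (Ew : E w = cis phi * ((Cexp u - 1) + Cexp u * (G w - 1))).
    { unfold E. replace (Cexp w) with (cis phi * Cexp u).
      - ring.
      - unfold cis. rewrite <- Cexp_plus. f_equal. unfold u, x0. ring. }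
    rewrite Ew, Cmod_mult, Cmod_cis, Rmult_1_l.
    assert (T := Cmod_triangle ((Cexp u - 1) + Cexp u * (G w - 1)) (- (Cexp u * (G w - 1)))).
    replace (Cexp u - 1 + Cexp u * (G w - 1) + - (Cexp u * (G w - 1))) with (Cexp u - 1) in T by ring.
    rewrite Cmod_opp, Cmod_mult in T.
    assert (X := HB w ltac:(assert (Y := Hin w ltac:(fold u; lra)); lra)).
    assert (Y := Cmod_ge_0 (G w - 1)). assert (Z := Cmod_ge_0 (Cexp u)). nra. }
  assert (Hx00 : (Cmod (x0 - x0) <= 1 / 4)%R).
  { replace (x0 - x0) with (RtoC 0) by ring. rewrite Cmod_0. lra. }
  (* |E| is at most 8 eps at the centre and at least 1/8 - 16 eps on the circle. Since 24 eps < 1/8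
     for eps < 1/200, this contradicts the mean value bound for 1/E. *)
  assert (HM := mean_value_bound (fun w => / E w) x0 _ (1 / 4) ltac:(lra)
     (fun w Hw => ex_intro _ _ (is_cderive_inv E w _ (HE w) (HE0 w Hw)))
     (is_cderive_inv E x0 _ (HE x0) (HE0 x0 Hx00)) (/ (1 / 8 - 16 * eps))).
  cbv beta in HM.
  assert (H1 : (Cmod (/ E x0) <= / (1 / 8 - 16 * eps))%R).
  { apply HM. intros w Hw. rewrite Cmod_inv by (apply HE0; lra).
    apply Rinv_le_contravar; [lra|auto]. }
  rewrite Cmod_inv in H1 by (apply HE0; auto).
  assert (P : (0 < Cmod (E x0))%R) by (apply Cmod_gt_0, HE0; auto).
  apply Rinv_le_contravar in H1; [|apply Rinv_0_lt_compat; lra].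
  rewrite !Rinv_inv in H1. lra.
Qed.

(** G = F e^(-x) has real part at most 1 + eps, so it is nearly 1 on the disc of half the radius.
    From F' = e^x G' + F and F'' = e^x G'' + 2 F' - F, both derivatives have modulus 1 up to a
    multiple of eps wherever |F| = 1; the bounds 1/4 and 4 are generous. *)
Lemma exponential_like F dF ddF (eps : R) :
  is_derivative F dF -> is_derivative dF ddF -> F 0 = 1 -> (0 < eps < 1 / 200)%R ->
  (forall x, (Cmod x <= 12)%R -> (Cmod (F x) <= (1 + eps) * exp (Re x))%R) ->
  forall phi, (-4 <= phi <= 4)%R -> exists x, (Cmod x <= 5)%R /\ F x = cis phi /\
    (1 / 4 <= Cmod (dF x))%R /\ (Cmod (ddF x) <= 4)%R.
Proof.
  intros HF HdF F0 Heps HB phi Hphi.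
  set (G := fun x => F x * Cexp (- x)). set (dG := fun x => (dF x - F x) * Cexp (- x)).
  set (ddG := fun x => (ddF x - RtoC 2 * dF x + F x) * Cexp (- x)).
  assert (Hem : forall x, is_cderive (fun x => Cexp (- x)) x (- Cexp (- x))).
  { intros x. eapply is_cderive_eq.
    - apply (is_cderive_comp Cexp (fun x => - x)); [apply is_cderive_Cexp|].
      apply is_cderive_opp, is_cderive_id.
    - cbv beta. ring. }
  assert (HG : is_derivative G dG).
  { intros x. eapply is_cderive_eq; [apply is_cderive_mult; [apply HF|apply Hem]|].
    unfold dG; cbv beta. ring. }
  assert (HdG : is_derivative dG ddG).
  { intros x. eapply is_cderive_eq.
    - apply is_cderive_mult; [apply is_cderive_minus; [apply HdF|apply HF]|apply Hem].
    - unfold ddG; cbv beta. ring. }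
  assert (Hexp : forall x, Cexp x * Cexp (- x) = 1).
  { intros x. rewrite <- Cexp_plus. replace (x + - x) with (RtoC 0) by ring. apply Cexp_0. }
  assert (HFG : forall x, F x = Cexp x * G x).
  { intros x. unfold G. rewrite <- (Cmult_1_r (F x)) at 1. rewrite <- (Hexp x). ring. }
  assert (HGB : forall x, (Cmod x <= 12)%R -> (Re (G x) <= 1 + eps)%R).
  { intros x Hx. apply Rle_trans with (Cmod (G x)).
    - eapply Rle_trans; [apply Rle_abs|apply re_le_Cmod].
    - unfold G. rewrite Cmod_mult, Cmod_Cexp.
      replace (1 + eps)%R with ((1 + eps) * exp (Re x) * exp (Re (- x)%C))%R.
      + apply Rmult_le_compat_r; [left; apply exp_pos|auto].
      + rewrite Rmult_assoc, <- exp_plus. replace (Re x + Re (- x)%C)%R with 0%R.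
        * rewrite exp_0. ring.
        * unfold Re; simpl. ring. }
  assert (G0 : G 0 = 1) by (unfold G; rewrite F0, Copp_0, Cexp_0; ring).
  assert (HN := near_constant G dG eps 12 HG G0 ltac:(lra) HGB).
  destruct (covers_unit_circle G dG eps phi HG Heps) as [x [Hx HxE]]; auto.
  { intros x Hx. apply HN. lra. }
  exists x. split; [exact Hx|]. rewrite <- HFG in HxE. split; [exact HxE|].
  destruct (HN x ltac:(lra)) as [N1 N2].
  assert (Hdd : (1 * Cmod (ddG x) <= 2 * eps)%R).
  { apply (circle_deriv_bound dG x (ddG x) 1 ltac:(lra) (is_derivative_disc _ _ x 1 HdG) (HdG x)).
    intros w Hw. assert (T := Cmod_le_add x w 5 1 Hx (Req_le _ _ Hw)).
    destruct (HN w ltac:(lra)) as [N3 _]. lra. }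
  assert (HF1 : Cmod (F x) = 1%R) by (rewrite HxE; apply Cmod_cis).
  assert (He : (Cmod (Cexp x) <= 2)%R).
  { assert (X : (Cmod (Cexp x) * Cmod (G x) = 1)%R) by (rewrite <- Cmod_mult, <- HFG; exact HF1).
    assert (T := Cmod_triangle (G x) (- (G x - 1))). rewrite Cmod_opp in T.
    replace (G x + - (G x - 1)) with (RtoC 1) in T by ring. rewrite Cmod_1 in T.
    assert (Y := Cmod_ge_0 (Cexp x)). nra. }
  assert (He0 := Cmod_ge_0 (Cexp x)).
  assert (D1 : dF x = Cexp x * dG x + F x).
  { unfold dG. transitivity (Cexp x * Cexp (- x) * (dF x - F x) + F x); [rewrite Hexp; ring|ring]. }
  assert (D2 : ddF x = Cexp x * ddG x + (RtoC 2 * dF x - F x)).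
  { unfold ddG. transitivity (Cexp x * Cexp (- x) * (ddF x - RtoC 2 * dF x + F x) + (RtoC 2 * dF x - F x));
      [rewrite Hexp; ring|ring]. }
  assert (B1 : (Cmod (Cexp x * dG x) <= 4 * eps)%R).
  { rewrite Cmod_mult. assert (X := Cmod_ge_0 (dG x)).
    assert (16 * eps / 12 <= 2 * eps)%R by lra. nra. }
  assert (B2 : (Cmod (Cexp x * ddG x) <= 4 * eps)%R).
  { rewrite Cmod_mult. assert (X := Cmod_ge_0 (ddG x)). nra. }
  assert (T1 := Cmod_triangle (dF x) (- (Cexp x * dG x))). rewrite Cmod_opp in T1.
  replace (dF x + - (Cexp x * dG x)) with (F x) in T1 by (rewrite D1; ring).
  assert (T2 := Cmod_triangle (Cexp x * dG x) (F x)). rewrite <- D1 in T2.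
  assert (T3 := Cmod_triangle (Cexp x * ddG x) (RtoC 2 * dF x - F x)). rewrite <- D2 in T3.
  assert (T4 := Cmod_triangle (RtoC 2 * dF x) (- F x)).
  rewrite Cmod_opp, Cmod_mult, Cmod_R, Rabs_right in T4 by lra.
  unfold Cminus in T3. split; lra.
Qed.

(** * Existence of normal points *)

Lemma inv_one_minus_bound (x : R) : (Rabs x <= 1 / 2)%R -> (/ (1 - x) <= exp (x + 2 * x ^ 2))%R.
Proof.
  intros Hx. apply Rabs_le_between in Hx.
  assert (H := exp_ineq1_le (x + 2 * x ^ 2)). assert (P := exp_pos (x + 2 * x ^ 2)).
  apply Rmult_le_reg_l with (1 - x)%R; [lra|]. rewrite Rinv_r by lra.
  (* The product equals 1 + x^2 (1 - 2 x), which is at least 1 for x <= 1/2. *)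
  apply Rle_trans with ((1 - x) * (1 + (x + 2 * x ^ 2)))%R; [simpl; nra|].
  apply Rmult_le_compat_l; lra.
Qed.

Lemma exp_pow (x : R) (n : nat) : (exp x ^ n = exp (INR n * x))%R.
Proof.
  induction n; [simpl; rewrite Rmult_0_l, exp_0; reflexivity|].
  rewrite S_INR. simpl. rewrite IHn, <- exp_plus. f_equal. ring.
Qed.

(** The N-th power of y / N <= exp (y / N). It trades the N-th power in the penalty for a single
    exponential. *)
Lemma pow_le_exp (N : nat) (y : R) : (0 < INR N)%R -> (0 <= y)%R -> (y ^ N <= INR N ^ N * exp y)%R.
Proof.
  intros HN Hy.
  assert (H := exp_ineq1_le (y / INR N)).
  replace (exp y) with (exp (y / INR N) ^ N)%R.
  - rewrite <- Rpow_mult_distr. apply pow_incr. split; auto.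
    replace y with (INR N * (y / INR N))%R at 1 by (field; lra).
    apply Rmult_le_compat_l; lra.
  - rewrite exp_pow. f_equal. field; lra.
Qed.

(* Almost maximising |L z| |z|^-d (S - ln|z|)^N over 1 <= |z| < e^S gives a point where
   ln |L| lies below its linearisation of slope K = d + N / (S - ln|z0|) in ln|z|, up to eps,
   on the scale 1 / K. *)
Lemma normal_point L dL (d : nat) (eps C0 : R) : is_derivative L dL ->
  (0 < eps < 1)%R -> (0 < C0)%R -> (1 <= d)%nat ->
  (forall C : R, (0 < C)%R -> exists z, (C * (1 + Cmod z) ^ S d < Cmod (L z))%R) ->
  exists (z0 : C) (K : R), (1 <= K)%R /\ (1 <= Cmod z0)%R /\
    (C0 * Cmod z0 ^ d <= Cmod (L z0))%R /\
    forall x, (Cmod x <= 12)%R ->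
      (Cmod (L (z0 * Cexp (x / RtoC K))%C) <= (1 + eps) * Cmod (L z0) * exp (Re x))%R.
Proof.
  intros HL Heps HC0 Hd Hgrow.
  (* The relative displacement y introduced below satisfies N |y| <= 12. Then N > 24 gives |y| <=
     1/2, and N eps / 4 >= 2 * 144 makes the quadratic error 2 N y^2 at most eps / 4. *)
  destruct (INR_unbounded (2 * 144 / (eps / 4) + 24)) as [N HN].
  assert (HNe : (2 * 144 <= INR N * (eps / 4))%R).
  { replace (2 * 144)%R with (2 * 144 / (eps / 4) * (eps / 4))%R at 1 by (field; lra).
    apply Rmult_le_compat_r; [lra|]. lra. }
  assert (HN24 : (24 < INR N)%R).
  { assert (X : (0 < 2 * 144 / (eps / 4))%R) by (apply Rdiv_lt_0_compat; lra). lra. }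
  clear HN.
  assert (HD1 : (1 <= INR d)%R) by (apply (le_INR 1); exact Hd).
  assert (PN : (0 < INR N ^ N)%R) by (apply pow_lt; lra).
  destruct (derivable_bounded L dL (exp 12) HL) as [M [HM HMb]].
  (* The factor 6 N^N collects the losses in comparing z0 with z1: 2 for 1 + e0, 3 for the number e,
     and N^N from [pow_le_exp]. The last M forces |z1| above e^12; the M in the bracket does the
     same for |z0|. *)
  set (Cg := ((C0 + M + 1) * (6 * INR N ^ N) + M)%R).
  assert (HC : (0 < Cg)%R) by (unfold Cg; nra).
  destruct (Hgrow Cg HC) as [z1 Hz1].
  assert (Z1 := Cmod_ge_0 z1).
  assert (HCM : (M < Cg)%R) by (unfold Cg; nra).
  assert (Hpow1 : forall (w : C) k, (1 <= (1 + Cmod w) ^ k)%R).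
  { intros w k. apply pow_R1_Rle. assert (X := Cmod_ge_0 w). lra. }
  assert (Hz1e : (exp 12 < Cmod z1)%R).
  { apply Rnot_le_lt. intros H. assert (X := HMb z1 H). assert (Y := Hpow1 z1 (S d)). nra. }
  assert (He12 := exp_ineq1_le 12).
  set (s1 := ln (Cmod z1)).
  assert (Es1 : exp s1 = Cmod z1) by (apply exp_ln; lra).
  assert (Hs1 : (0 <= s1)%R).
  { unfold s1. rewrite <- ln_1. left; apply ln_increasing; lra. }
  set (S0 := (s1 + 1)%R).
  set (Psi := fun z => (Cmod (L z) * exp (- (INR d * ln (Cmod z))) * (S0 - ln (Cmod z)) ^ N)%R).
  set (dom := fun z => (1 <= Cmod z)%R /\ (ln (Cmod z) < S0)%R).
  assert (Hln0 : forall z, (1 <= Cmod z)%R -> (0 <= ln (Cmod z))%R).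
  { intros z Hz. rewrite <- ln_1. destruct Hz as [Hz|Hz]; [left; apply ln_increasing; lra|right; f_equal; auto]. }
  destruct (derivable_bounded L dL (exp S0) HL) as [M2 [HM2 HM2b]].
  assert (Hbd : forall z, dom z -> (Psi z <= M2 * 1 * S0 ^ N)%R).
  { intros z [Hz1' Hz2]. assert (X := Hln0 z Hz1'). unfold Psi.
    assert (P0 := Cmod_ge_0 (L z)). assert (P1 := exp_pos (- (INR d * ln (Cmod z)))).
    apply Rmult_le_compat.
    - nra.
    - apply pow_le; lra.
    - apply Rmult_le_compat; try lra.
      + apply HM2b. rewrite <- (exp_ln (Cmod z)) by lra. apply exp_le_compat; lra.
      + rewrite <- exp_0. apply exp_le_compat. nra.
    - apply pow_incr; lra. }
  assert (Hd1 : dom z1) by (split; [lra|fold s1; unfold S0; lra]).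
  destruct (completeness (fun y => exists z, dom z /\ y = Psi z)) as [sigma [Hub Hlub]].
  { exists (M2 * 1 * S0 ^ N)%R. intros y [z [Hz ->]]. auto. }
  { exists (Psi z1). exists z1; auto. }
  (* Psi z1 is large because S0 - ln|z1| = 1. *)
  assert (HPsi1 : (Cg * exp s1 <= Psi z1)%R).
  { unfold Psi. fold s1. replace (S0 - s1)%R with 1%R by (unfold S0; ring).
    rewrite pow1, Rmult_1_r.
    assert (E1 : (exp (INR d * s1) * exp (- (INR d * s1)) = 1)%R)
      by (rewrite <- exp_plus, Rplus_opp_r; apply exp_0).
    assert (P1 := exp_pos (- (INR d * s1))). assert (P2 := exp_pos s1).
    assert (E2 : (exp s1 ^ S d = exp s1 * exp (INR d * s1))%R) by (simpl; rewrite exp_pow; reflexivity).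
    assert (E3 : (Cg * exp s1 ^ S d <= Cmod (L z1))%R).
    { apply Rle_trans with (Cg * (1 + Cmod z1) ^ S d)%R; [|lra].
      apply Rmult_le_compat_l; [lra|]. apply pow_incr. rewrite Es1. lra. }
    replace (Cg * exp s1)%R with (Cg * exp s1 ^ S d * exp (- (INR d * s1)))%R.
    - apply Rmult_le_compat_r; [lra|auto].
    - rewrite E2. transitivity (Cg * exp s1 * (exp (INR d * s1) * exp (- (INR d * s1))))%R; [ring|].
      rewrite E1; ring. }
  assert (Hsig : (0 < sigma)%R).
  { apply Rlt_le_trans with (Psi z1).
    - assert (P2 := exp_pos s1). nra.
    - apply Hub. exists z1; auto. }
  set (e0 := (eps / 4)%R) in *.
  assert (He0 : (0 < e0)%R) by (unfold e0; lra).
  (* An almost maximiser costs a factor 1 + e0 and spares the question whether the supremum is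
     attained. *)
  assert (Hex : exists z0, dom z0 /\ (sigma <= (1 + e0) * Psi z0)%R).
  { apply NNPP. intros HNo.
    assert (X : (sigma <= sigma / (1 + e0))%R).
    { apply Hlub. intros y [z [Hz ->]].
      destruct (Rle_lt_dec (Psi z) (sigma / (1 + e0))) as [|Hlt]; auto.
      exfalso. apply HNo. exists z. split; auto.
      replace sigma with ((1 + e0) * (sigma / (1 + e0)))%R by (field; lra).
      apply Rmult_le_compat_l; lra. }
    assert (Y : (sigma / (1 + e0) * (1 + e0) = sigma)%R) by (field; lra). nra. }
  destruct Hex as [z0 [[Hz01 Hz02] Hz0]].
  set (s0 := ln (Cmod z0)) in *.
  assert (Es0 : exp s0 = Cmod z0) by (apply exp_ln; lra).
  assert (Hs0 : (0 <= s0)%R) by (apply Hln0; auto).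
  assert (Hmax : forall z, dom z -> (Psi z <= (1 + e0) * Psi z0)%R).
  { intros z Hz. apply Rle_trans with sigma; auto. apply Hub. exists z; auto. }
  assert (Q : (0 < S0 - s0)%R) by lra.
  assert (P3 := exp_pos (- (INR d * s0))).
  (* The growth hypothesis has exponent d + 1, whereas [Psi] divides by |z|^d only; the spare factor
     e^s1 in [HPsi1] cancels the one in (S0 - s0)^N <= 3 N^N e^s1. *)
  assert (Hbig : (C0 + M + 1 <= Cmod (L z0) * exp (- (INR d * s0)))%R).
  { assert (X := Hmax z1 Hd1). unfold Psi at 2 in X. fold s0 in X.
    set (B := (Cmod (L z0) * exp (- (INR d * s0)))%R) in *.
    assert (B0 : (0 <= B)%R) by (apply Rmult_le_pos; [apply Cmod_ge_0|lra]).
    assert (X1 : ((S0 - s0) ^ N <= S0 ^ N)%R) by (apply pow_incr; lra).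
    assert (X2 := pow_le_exp N S0 ltac:(lra) ltac:(unfold S0; lra)).
    assert (X3 : (exp S0 <= exp s1 * 3)%R).
    { unfold S0. rewrite exp_plus. apply Rmult_le_compat_l; [left; apply exp_pos|apply exp_le_3]. }
    assert (X4 : ((S0 - s0) ^ N <= INR N ^ N * (exp s1 * 3))%R).
    { eapply Rle_trans; [exact X1|]. eapply Rle_trans; [exact X2|].
      apply Rmult_le_compat_l; lra. }
    assert (Pe := exp_pos s1).
    assert (X5 : ((1 + e0) * (B * (S0 - s0) ^ N) <= 2 * (B * (INR N ^ N * (exp s1 * 3))))%R).
    { assert (Y : (B * (S0 - s0) ^ N <= B * (INR N ^ N * (exp s1 * 3)))%R)
        by (apply Rmult_le_compat_l; auto).
      assert (Y0 : (0 <= (S0 - s0) ^ N)%R) by (apply pow_le; lra).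
      assert (Y1 : (0 <= B * (S0 - s0) ^ N)%R) by (apply Rmult_le_pos; auto).
      unfold e0. nra. }
    assert (X6 : (Cg * exp s1 <= 6 * INR N ^ N * B * exp s1)%R).
    { replace (6 * INR N ^ N * B * exp s1)%R with (2 * (B * (INR N ^ N * (exp s1 * 3))))%R by ring. lra. }
    apply Rmult_le_reg_r in X6; auto.
    unfold Cg in X6. apply Rmult_le_reg_l with (6 * INR N ^ N)%R; lra. }
  assert (Ed : (exp (INR d * s0) = Cmod z0 ^ d)%R) by (rewrite <- exp_pow, Es0; reflexivity).
  assert (Edd : (exp (INR d * s0) * exp (- (INR d * s0)) = 1)%R)
    by (rewrite <- exp_plus, Rplus_opp_r; apply exp_0).
  assert (P4 := exp_pos (INR d * s0)).
  assert (Hbig2 : ((C0 + M + 1) * Cmod z0 ^ d <= Cmod (L z0))%R).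
  { rewrite <- Ed.
    replace (Cmod (L z0)) with (Cmod (L z0) * exp (- (INR d * s0)) * exp (INR d * s0))%R.
    - apply Rmult_le_compat_r; lra.
    - rewrite Rmult_assoc, (Rmult_comm (exp (- _))), Edd. ring. }
  assert (Hz0d : (1 <= Cmod z0 ^ d)%R) by (apply pow_R1_Rle; auto).
  (* Room for a displacement t >= -12: the comparison point stays in |z| >= 1. *)
  assert (Hs012 : (12 < s0)%R).
  { apply Rnot_le_lt. intros Hle.
    assert (X : (Cmod (L z0) <= M)%R).
    { apply HMb. rewrite <- Es0. apply exp_le_compat; auto. }
    nra. }
  (* Slope at s0 of d s - N ln (S0 - s), which is ln |L| - ln Psi expressed in s = ln |z|. *)
  set (K := (INR d + INR N / (S0 - s0))%R).
  assert (HNq : (0 < INR N / (S0 - s0))%R) by (apply Rdiv_lt_0_compat; lra).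
  assert (HK : (1 <= K)%R) by (unfold K; lra).
  assert (HKq : (INR N <= K * (S0 - s0))%R).
  { unfold K. rewrite Rmult_plus_distr_r. unfold Rdiv. rewrite Rmult_assoc, Rinv_l by lra. nra. }
  exists z0, K. split; [exact HK|]. split; [exact Hz01|]. split; [nra|].
  intros x Hx.
  set (X := Re x). set (t := (X / K)%R).
  assert (HX : (Rabs X <= 12)%R) by (eapply Rle_trans; [apply re_le_Cmod|exact Hx]).
  assert (KN : RtoC K <> 0) by (intros E; apply RtoC_inj in E; lra).
  assert (Hmod : Cmod (z0 * Cexp (x / RtoC K)) = exp (s0 + t)).
  { rewrite Cmod_mult, Cmod_Cexp, exp_plus, Es0. f_equal. f_equal.
    unfold t, X. destruct x as [a b]. unfold Cdiv, Cinv, Cmult, RtoC, Re; simpl. field. lra. }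
  set (z := z0 * Cexp (x / RtoC K)) in *.
  assert (Hlnz : ln (Cmod z) = (s0 + t)%R) by (rewrite Hmod; apply ln_exp).
  assert (HXK : X = (K * t)%R) by (unfold t; field; lra).
  (* The displacement relative to the distance from the outer edge S0; K (S0 - s0) >= N makes it at
     most 12 / N in absolute value. *)
  set (y := (t / (S0 - s0))%R).
  assert (Hty : t = (y * (S0 - s0))%R) by (unfold y; field; lra).
  assert (HyN : (INR N * Rabs y <= 12)%R).
  { apply Rle_trans with (K * (S0 - s0) * Rabs y)%R.
    - apply Rmult_le_compat_r; [apply Rabs_pos|auto].
    - replace (K * (S0 - s0) * Rabs y)%R with (Rabs X); auto.
      rewrite HXK, Hty, !Rabs_mult, (Rabs_right K), (Rabs_right (S0 - s0)) by lra. ring. }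
  assert (Hy0 := Rabs_pos y).
  assert (Hy : (Rabs y <= 1 / 2)%R) by nra.
  assert (Hyb := proj1 (Rabs_le_between y (1 / 2)) Hy).
  assert (Ht12 : (-12 <= t)%R).
  { assert (HXb := proj1 (Rabs_le_between X 12) HX). nra. }
  assert (Hgap : (S0 - (s0 + t) = (S0 - s0) * (1 - y))%R) by (rewrite Hty; ring).
  assert (Hdz : dom z).
  { split.
    - rewrite Hmod, <- exp_0. apply exp_le_compat. lra.
    - rewrite Hlnz. nra. }
  assert (HP := Hmax z Hdz). unfold Psi in HP. rewrite Hlnz in HP. fold s0 in HP.
  rewrite Hgap, Rpow_mult_distr in HP.
  set (q := ((S0 - s0) ^ N)%R) in *. assert (Hq : (0 < q)%R) by (apply pow_lt; auto).
  assert (Hyp : (0 < 1 - y)%R) by lra.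
  assert (Hyq : (0 < (1 - y) ^ N)%R) by (apply pow_lt; auto).
  (* Almost-maximality of [Psi] at z0, solved for |L z|. *)
  assert (A1 : (Cmod (L z) <= (1 + e0) * Cmod (L z0) * exp (INR d * t) * (/ (1 - y)) ^ N)%R).
  { rewrite pow_inv.
    apply Rmult_le_reg_r with (exp (- (INR d * (s0 + t))) * (q * (1 - y) ^ N))%R.
    - apply Rmult_lt_0_compat; [apply exp_pos|]. apply Rmult_lt_0_compat; auto.
    - rewrite <- Rmult_assoc. eapply Rle_trans; [exact HP|]. right.
      replace (exp (- (INR d * s0))) with (exp (INR d * t) * exp (- (INR d * (s0 + t))))%R
        by (rewrite <- exp_plus; f_equal; ring).
      field. lra. }
  assert (A2 : ((/ (1 - y)) ^ N <= exp (INR N * (y + 2 * y ^ 2)))%R).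
  { rewrite <- exp_pow. apply pow_incr. split.
    - left; apply Rinv_0_lt_compat; auto.
    - apply inv_one_minus_bound; auto. }
  assert (A3 : (INR N * (2 * y ^ 2) <= e0)%R).
  { assert (Y2 : (y ^ 2 = Rabs y * Rabs y)%R).
    { simpl. rewrite Rmult_1_r, <- Rabs_mult, Rabs_right; nra. }
    rewrite Y2.
    apply Rmult_le_reg_l with (INR N); [lra|].
    apply Rle_trans with (2 * 144)%R; [|exact HNe].
    replace (INR N * (INR N * (2 * (Rabs y * Rabs y))))%R with
      (2 * ((INR N * Rabs y) * (INR N * Rabs y)))%R by ring.
    assert (W : (0 <= INR N * Rabs y)%R) by nra. nra. }
  (* The first-order terms d t + N y add up to K t = Re x, so only the quadratic error remains. *)
  assert (A4 : (exp (INR d * t) * (/ (1 - y)) ^ N <= exp X * exp e0)%R).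
  { apply Rle_trans with (exp (INR d * t) * exp (INR N * (y + 2 * y ^ 2)))%R.
    - apply Rmult_le_compat_l; [left; apply exp_pos|auto].
    - rewrite <- !exp_plus. apply exp_le_compat.
      assert (EK : (K * t = INR d * t + INR N * y)%R) by (unfold K, y; field; lra).
      rewrite HXK, EK. lra. }
  assert (A5 : (exp e0 <= 1 + 2 * e0)%R).
  { assert (Y := exp_ineq1_le (- e0)). assert (Y2 := exp_pos e0).
    assert (Y3 : (exp e0 * exp (- e0) = 1)%R) by (rewrite <- exp_plus, Rplus_opp_r; apply exp_0).
    assert (Y4 : (e0 <= 1 / 4)%R) by (unfold e0; lra). nra. }
  assert (PL := Cmod_ge_0 (L z0)). assert (PX := exp_pos X).
  eapply Rle_trans; [exact A1|].
  apply Rle_trans with ((1 + e0) * Cmod (L z0) * (exp X * exp e0))%R.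
  - rewrite Rmult_assoc. apply Rmult_le_compat_l; [nra|auto].
  - replace ((1 + e0) * Cmod (L z0) * (exp X * exp e0))%R with
      ((1 + e0) * exp e0 * (Cmod (L z0) * exp X))%R by ring.
    rewrite (Rmult_assoc (1 + eps)). apply Rmult_le_compat_r; [nra|].
    apply Rle_trans with ((1 + e0) * (1 + 2 * e0))%R; [apply Rmult_le_compat_l; lra|].
    unfold e0. nra.
Qed.

(** * The equation for kap *)

(** The arc cosine gives the angle up to sign, which the imaginary part decides; 4 serves as a
    rational bound for pi. *)
Lemma unit_cis (u : C) : Cmod u = 1%R -> exists phi : R, (-4 <= phi <= 4)%R /\ u = cis phi.
Proof.
  destruct u as [c s]. intros Hu.
  assert (H2 : (c ^ 2 + s ^ 2 = 1)%R).
  { assert (X := Cmod2_alt (c, s)). rewrite Hu in X. simpl in X. simpl. lra. }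
  assert (Hc : (-1 <= c <= 1)%R) by (simpl in H2; nra).
  assert (B := acos_bound c). assert (P := PI_4).
  assert (Ecis : forall phi, cis phi = (cos phi, sin phi)).
  { intros phi. unfold cis, Cexp. simpl.
    replace (phi * 0 - 0 * 1)%R with 0%R by ring. replace (phi * 1 + 0 * 0)%R with phi by ring.
    rewrite exp_0, !Rmult_1_l. reflexivity. }
  assert (Es : (1 - c² = s²)%R) by (unfold Rsqr; simpl in H2; lra).
  destruct (Rle_lt_dec 0 s) as [S|S].
  - exists (acos c). split; [lra|].
    rewrite Ecis, cos_acos, sin_acos, Es, sqrt_Rsqr; auto.
  - exists (- acos c)%R. split; [lra|].
    rewrite Ecis, cos_neg, sin_neg, cos_acos, sin_acos, Es by auto.
    rewrite sqrt_Rsqr_abs, Rabs_left, Ropp_involutive; auto.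
Qed.

(* kap (L z) L'(z) + L''(z) / L'(z) = p'(z) is the logarithmic derivative of
   g'(L(z)) L'(z) = e^p(z), with kap = g''/g'. Near a normal point L covers the circle
   |w| = |L z0|, and there the equation forces kap to be small. *)
Lemma log_derivative_vanishes L dL ddL kap dkap dp (d : nat) (Cp : R) :
  is_derivative L dL -> is_derivative dL ddL -> is_derivative kap dkap ->
  (forall z, dL z <> 0) -> (forall z, kap (L z) * dL z + ddL z / dL z = dp z) ->
  (1 <= d)%nat -> (0 < Cp)%R -> (forall z, (Cmod (z * dp z)%C <= Cp * (1 + Cmod z) ^ d)%R) ->
  (forall A : R, (0 < A)%R -> exists z, (A * (1 + Cmod z) ^ S d < Cmod (L z))%R) ->
  kap 0 = 0.
Proof.
  intros HL HdL Hkap HN Heq Hd HCp Hdp Hgrow.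
  destruct (Ceq_dec (kap 0) 0) as [|Nk]; auto. exfalso.
  apply Cmod_gt_0 in Nk. set (c := Cmod (kap 0)) in *.
  assert (H51 : (1 <= exp 5)%R) by (assert (X := exp_ineq1_le 5); lra).
  assert (P5 : (0 < (2 * exp 5) ^ d)%R) by (apply pow_lt; lra).
  (* 68 = 4 (1 + 16): the 1 is the summand in [Ek], 16 bounds |F'' / F'|, and 4 inverts |F'| >= 1/4.
     The factor 2 e^5 bounds (1 + |zeta x|) / |z0| for |x| <= 5. *)
  set (B := (4 * (Cp * (2 * exp 5) ^ d) + 68)%R).
  assert (HB : (0 < B)%R) by (unfold B; nra).
  (* With |L z0| >= (2 B / c) |z0|^d, the bound B |z0|^d / |L z0| for |kap| on the circle becomes c
     / 2, half of |kap(0)|. *)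
  assert (HC0 : (0 < 2 * B / c)%R) by (apply Rdiv_lt_0_compat; lra).
  destruct (normal_point L dL d (1 / 1000) (2 * B / c) HL ltac:(lra) HC0 Hd Hgrow)
    as [z0 [K [HK [Hz0 [HL0 HF]]]]].
  set (l0 := L z0) in *.
  assert (Hzd : (1 <= Cmod z0 ^ d)%R) by (apply pow_R1_Rle; auto).
  assert (Pl0 : (0 < Cmod l0)%R) by nra.
  assert (Nl0 : l0 <> 0) by (apply Cmod_gt_0; auto).
  assert (Nz0 : z0 <> 0) by (apply Cmod_gt_0; lra).
  assert (NK : RtoC K <> 0) by (intros E; apply RtoC_inj in E; lra).
  set (zeta := fun x => z0 * Cexp (x / RtoC K)).
  assert (Nzeta : forall x, zeta x <> 0) by (intros x; apply Cmult_neq_0; auto; apply Cexp_neq_0).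
  assert (Hzeta : is_derivative zeta (fun x => zeta x / RtoC K)).
  { intros x. eapply is_cderive_eq.
    - apply is_cderive_mult; [apply is_cderive_const|].
      apply (is_cderive_comp Cexp (fun x => x / RtoC K)); [apply is_cderive_Cexp|].
      apply is_cderive_mult; [apply is_cderive_id|apply is_cderive_const].
    - unfold zeta; cbv beta. field. auto. }
  (* [L] in the coordinate x, normalised to F(0) = 1; on functions of z = zeta x, d/dx acts as (z /
     K) d/dz. *)
  set (F := fun x => / l0 * L (zeta x)).
  set (dF := fun x => / (l0 * RtoC K) * (zeta x * dL (zeta x))).
  set (ddF := fun x => / (l0 * RtoC K * RtoC K) *
     (zeta x * dL (zeta x) + zeta x * zeta x * ddL (zeta x))).
  assert (HFd : is_derivative F dF).
  { intros x. eapply is_cderive_eq.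
    - apply is_cderive_mult; [apply is_cderive_const|].
      apply (is_cderive_comp L zeta); [apply HL|apply Hzeta].
    - unfold dF; cbv beta. field. auto. }
  assert (HdFd : is_derivative dF ddF).
  { intros x. eapply is_cderive_eq.
    - apply is_cderive_mult; [apply is_cderive_const|].
      apply is_cderive_mult; [apply Hzeta|].
      apply (is_cderive_comp dL zeta); [apply HdL|apply Hzeta].
    - unfold ddF; cbv beta. field. auto. }
  assert (HF0 : F 0 = 1).
  { unfold F, zeta. replace (0 / RtoC K) with (RtoC 0) by (field; auto).
    rewrite Cexp_0, Cmult_1_r. fold l0. field. auto. }
  assert (HFB : forall x, (Cmod x <= 12)%R -> (Cmod (F x) <= (1 + 1 / 1000) * exp (Re x))%R).
  { intros x Hx. unfold F. rewrite Cmod_mult, Cmod_inv by auto.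
    apply Rmult_le_reg_l with (Cmod l0); auto.
    rewrite <- Rmult_assoc, Rinv_r, Rmult_1_l by lra.
    eapply Rle_trans; [apply HF; auto|]. right; ring. }
  assert (Hsmall : forall w, Cmod (w - 0) = Cmod l0 -> (Cmod (kap w) <= c / 2)%R).
  { intros w Hw. replace (w - 0) with w in Hw by ring.
    destruct (unit_cis (w / l0)) as [phi [Hphi Ephi]].
    { rewrite Cmod_div, Hw by auto. field. lra. }
    destruct (exponential_like F dF ddF (1 / 1000) HFd HdFd HF0 ltac:(lra) HFB phi Hphi)
      as [x [Hx [Ex [Hx1 Hx2]]]].
    rewrite <- Ephi in Ex. unfold F in Ex.
    assert (Ew : L (zeta x) = w).
    { transitivity (l0 * (/ l0 * L (zeta x))); [field; auto|]. rewrite Ex. field. auto. }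
    assert (E := Heq (zeta x)). rewrite Ew in E.
    assert (NdF : dF x <> 0) by (apply Cmod_gt_0; lra).
    (* The equation multiplied by z = zeta x, where z L' = K l0 F' and z L'' / L' = K F'' / F' -
       1. *)
    assert (Ek : kap w * (RtoC K * l0 * dF x) = zeta x * dp (zeta x) + 1 - RtoC K * ddF x / dF x).
    { rewrite <- E. unfold ddF, dF. field. auto. }
    apply (f_equal Cmod) in Ek. rewrite !Cmod_mult, Cmod_R, Rabs_right in Ek by lra.
    assert (T1 := Cmod_triangle (zeta x * dp (zeta x) + 1) (- (RtoC K * ddF x / dF x))).
    assert (T2 := Cmod_triangle (zeta x * dp (zeta x)) 1).
    rewrite Cmod_1 in T2. rewrite Cmod_opp, Cmod_div, Cmod_mult, Cmod_R, Rabs_right in T1 by (auto; lra).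
    unfold Cminus in Ek. rewrite <- Ek in T1.
    assert (Hq : (K * Cmod (ddF x) / Cmod (dF x) <= 16 * K)%R).
    { apply Rmult_le_reg_r with (Cmod (dF x)); [lra|].
      replace (K * Cmod (ddF x) / Cmod (dF x) * Cmod (dF x))%R with (K * Cmod (ddF x))%R
        by (field; lra).
      assert (Cmod (ddF x) <= 16 * Cmod (dF x))%R by lra. nra. }
    assert (Hzx : (1 + Cmod (zeta x) <= 2 * exp 5 * Cmod z0)%R).
    { unfold zeta. rewrite Cmod_mult, Cmod_Cexp.
      assert (R5 : (exp (Re (x / RtoC K)%C) <= exp 5)%R).
      { apply exp_le_compat.
        eapply Rle_trans; [apply Rle_abs|]. eapply Rle_trans; [apply re_le_Cmod|].
        rewrite Cmod_div, Cmod_R, Rabs_right by (auto; lra).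
        apply Rmult_le_reg_r with K; [lra|].
        replace (Cmod x / K * K)%R with (Cmod x) by (field; lra). nra. }
      nra. }
    assert (Hzp : (Cmod (zeta x * dp (zeta x)) <= Cp * (2 * exp 5) ^ d * Cmod z0 ^ d)%R).
    { eapply Rle_trans; [apply Hdp|]. rewrite Rmult_assoc, <- Rpow_mult_distr.
      apply Rmult_le_compat_l; [lra|]. apply pow_incr. split; auto.
      assert (X := Cmod_ge_0 (zeta x)). lra. }
    assert (Hk0 := Cmod_ge_0 (kap w)).
    set (Q := Cmod (zeta x * dp (zeta x))) in *. assert (Q0 : (0 <= Q)%R) by apply Cmod_ge_0.
    assert (S1 : (Cmod (kap w) * (K * Cmod l0 * (1 / 4)) <= Q + 1 + 16 * K)%R).
    { apply Rle_trans with (Cmod (kap w) * (K * Cmod l0 * Cmod (dF x)))%R; [|lra].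
      apply Rmult_le_compat_l; auto. apply Rmult_le_compat_l; auto. nra. }
    assert (S2 : (Cmod (kap w) * Cmod l0 <= 4 * Q + 68)%R).
    { apply Rmult_le_reg_l with K; [lra|]. nra. }
    assert (S3 : (4 * Q + 68 <= B * Cmod z0 ^ d)%R) by (unfold B; nra).
    assert (S4 : (B * Cmod z0 ^ d <= c / 2 * Cmod l0)%R).
    { replace (B * Cmod z0 ^ d)%R with (c / 2 * (2 * B / c * Cmod z0 ^ d))%R by (field; lra).
      apply Rmult_le_compat_l; lra. }
    apply Rmult_le_reg_r with (Cmod l0); auto. lra. }
  assert (X := mean_value_bound kap 0 (dkap 0) (Cmod l0) Pl0 (is_derivative_disc _ _ _ _ Hkap)
     (Hkap 0) (c / 2) Hsmall).
  fold c in X. lra.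
Qed.

(** * Polynomials given by coefficient lists *)

Lemma Cpoly_eval_derivative p : exists dp, is_derivative (Cpoly_eval p) dp /\
  exists A : R, (0 < A)%R /\ forall z,
    (Cmod (Cpoly_eval p z) <= A * (1 + Cmod z) ^ length p)%R /\
    (Cmod (dp z) <= A * (1 + Cmod z) ^ length p)%R.
Proof.
  induction p as [|c p [dp [Hdp [A [HA HB]]]]].
  - exists (fun _ => 0). split; [intros z; apply is_cderive_const|].
    exists 1%R. split; [lra|]. intros z. simpl. rewrite Cmod_0. lra.
  - exists (fun z => Cpoly_eval p z + z * dp z). split.
    + intros z. simpl.
      eapply is_cderive_eq.
      * apply (is_cderive_plus (fun _ => c) (fun z => z * Cpoly_eval p z)); [apply is_cderive_const|].
        apply (is_cderive_mult (fun z => z)); [apply is_cderive_id|apply Hdp].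
      * ring.
    (* One more factor 1 + |z| per coefficient absorbs both terms of the derivative p + z p', so
       values and derivatives share a bound. *)
    + exists (Cmod c + A)%R. assert (C0 := Cmod_ge_0 c). split; [lra|]. intros z.
      destruct (HB z) as [B1 B2]. assert (Z := Cmod_ge_0 z).
      assert (P1 : (1 <= (1 + Cmod z) ^ length p)%R) by (apply pow_R1_Rle; lra).
      simpl length. simpl pow. set (q := ((1 + Cmod z) ^ length p)%R) in *.
      assert (Y1 := Cmod_ge_0 (Cpoly_eval p z)). assert (Y2 := Cmod_ge_0 (dp z)).
      assert (W : (1 <= (1 + Cmod z) * q)%R) by nra.
      assert (V1 : (Cmod z * Cmod (Cpoly_eval p z) <= Cmod z * (A * q))%R)
        by (apply Rmult_le_compat_l; auto).
      assert (V2 : (Cmod z * Cmod (dp z) <= Cmod z * (A * q))%R)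
        by (apply Rmult_le_compat_l; auto).
      assert (V3 : (Cmod c * 1 <= Cmod c * ((1 + Cmod z) * q))%R) by (apply Rmult_le_compat_l; auto).
      assert (V4 : (0 <= A * q)%R) by nra.
      split.
      * simpl. eapply Rle_trans; [apply Cmod_triangle|]. rewrite Cmod_mult.
        fold (Cpoly_eval p z). lra.
      * eapply Rle_trans; [apply Cmod_triangle|]. rewrite Cmod_mult. lra.
Qed.

(** Putting z = 0 removes the constant term. The remaining factor vanishes for z <> 0, and at 0 by
    continuity, so the induction continues. *)
Lemma Cpoly_eval_zero q : (forall z, Cpoly_eval q z = 0) -> forall k, nth k q (RtoC 0) = 0.
Proof.
  induction q as [|c q IH]; intros H k; [destruct k; reflexivity|].
  assert (Hc : c = 0).
  { rewrite <- (H 0). simpl. ring. }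
  destruct k as [|k]; [exact Hc|]. simpl. apply IH.
  assert (Hnz : forall z : C, z <> 0 -> Cpoly_eval q z = 0).
  { intros z Nz. assert (X : c + z * Cpoly_eval q z = 0) by exact (H z). rewrite Hc in X.
    transitivity (/ z * (0 + z * Cpoly_eval q z)); [field; auto|]. rewrite X. ring. }
  intros z. destruct (Ceq_dec z 0) as [->|Nz]; auto.
  destruct (Cpoly_eval_derivative q) as [dq [Hdq _]].
  apply Cmod_eq_0, Rle_antisym; [|apply Cmod_ge_0]. apply le_epsilon. intros eps He.
  destruct (is_cderive_continuous _ _ _ (Hdq 0) eps He) as [d [Hd Hc0]].
  assert (N : RtoC (d / 2) <> 0) by (intros E; apply RtoC_inj in E; lra).
  specialize (Hc0 (RtoC (d / 2))). rewrite (Hnz _ N) in Hc0.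
  rewrite Rplus_0_l, <- Cmod_opp.
  replace (- Cpoly_eval q 0) with (0 - Cpoly_eval q 0) by ring. apply Hc0.
  replace (RtoC (d / 2) - 0) with (RtoC (d / 2)) by ring. rewrite Cmod_R, Rabs_right; lra.
Qed.

Lemma Cpoly_nonconstant_derivative p dp : Cpoly_nonconstant p ->
  is_derivative (Cpoly_eval p) dp -> ~ (forall z, dp z = 0).
Proof.
  intros [k [Hk Nk]] Hdp H0.
  assert (Hc : forall z, Cpoly_eval p z = Cpoly_eval p 0).
  { apply derivative_zero_constant. intros z. eapply is_cderive_eq; [apply Hdp|apply H0]. }
  destruct p as [|c p]; [destruct k; auto|].
  destruct k as [|k]; [lia|]. simpl in Nk. apply Nk.
  (* Subtracting the value at 0 alters only the coefficient of index 0, so the list now evaluates to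
     zero everywhere and still carries the nonzero coefficient in question. *)
  change (nth (S k) ((c - Cpoly_eval (c :: p) 0) :: p) (RtoC 0) = 0).
  apply Cpoly_eval_zero. intros z.
  transitivity (Cpoly_eval (c :: p) z - Cpoly_eval (c :: p) 0); [simpl; ring|].
  rewrite Hc. ring.
Qed.

(** * Excluding the factorisation *)

Lemma derivative_unique f z a b : is_cderive f z a -> is_cderive f z b -> a = b.
Proof. intros Ha Hb. rewrite <- (is_C_derive_unique f z a Ha). apply is_C_derive_unique, Hb. Qed.

Theorem theorem7p11
  (p : Cpoly) (hp : Cpoly_nonconstant p) (hp0 : Cexp (Cpoly_eval p 0) = 1)
  (f : C -> C)
  (hf : forall z : C, f z = Cint (fun t => Cexp (Cpoly_eval p t)) 0 z) :
  (elh f /\ ~ AutC f) /\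
  ~ (exists L g : C -> C,
       (elh L /\ ~ AutC L) /\ (elh g /\ ~ AutC g) /\
       (forall w : C, exists z : C, L z = w) /\
       (forall z : C, f z = g (L z))).
Proof.
  destruct (Cpoly_eval_derivative p) as [dp [Hdp [A [HA HAB]]]].
  set (H := fun t => Cexp (Cpoly_eval p t)).
  assert (HdH : is_derivative H (fun z => H z * dp z)).
  { intros z. apply (is_cderive_comp Cexp (Cpoly_eval p)); [apply is_cderive_Cexp|apply Hdp]. }
  assert (Hf : is_derivative f H).
  { intros z. apply is_cderive_ext with (Cint H 0); [intros; symmetry; apply hf|].
    exact (Cint_derivative H _ HdH z). }
  assert (HH : forall z, H z <> 0) by (intros z; apply Cexp_neq_0).
  split; [split|].
  - split; [exact (is_derivative_entire f H Hf)|]. split.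
    + intros z. rewrite (is_derivative_unique f H Hf). apply HH.
    + rewrite (is_derivative_unique f H Hf). exact hp0.
  (* For a translation f, H = f' is constantly 1, so 0 = H' = H p' and p' vanishes. *)
  - intros [a Ha]. apply (Cpoly_nonconstant_derivative p dp hp Hdp). intros z.
    assert (H1 : forall w, RtoC 1 = H w).
    { intros w. apply (derivative_unique f w); [|apply Hf].
      apply is_cderive_ext with (fun w => a + 1 * w); [intros; rewrite Ha; ring|].
      apply is_cderive_affine. }
    assert (E : RtoC 0 = H z * dp z).
    { apply (derivative_unique H z); [|apply HdH].
      apply is_cderive_ext with (1 := H1). apply is_cderive_const. }
    rewrite <- H1, Cmult_1_l in E. auto.
  - intros [L [g [[[EL [NL L1]] AL] [[[Eg [Ng g1]] Ag] [_ Hcomp]]]]].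
    set (dL := C_derive L) in *. set (dg := C_derive g) in *.
    assert (HL : is_derivative L dL) by (apply is_derivative_C_derive; auto).
    assert (Hg : is_derivative g dg) by (apply is_derivative_C_derive; auto).
    destruct (derivative_derivable L dL HL) as [ddL HdL].
    destruct (derivative_derivable g dg Hg) as [ddg Hdg].
    destruct (derivative_derivable dg ddg Hdg) as [dddg Hddg].
    assert (E1 : forall z, dg (L z) * dL z = H z).
    { intros z. apply (derivative_unique f z); [|apply Hf].
      apply is_cderive_ext with (fun z => g (L z)); [intros; symmetry; apply Hcomp|].
      apply is_cderive_comp; [apply Hg|apply HL]. }
    assert (E2 : forall z, ddg (L z) * dL z * dL z + dg (L z) * ddL z = H z * dp z).
    { intros z. apply (derivative_unique H z); [|apply HdH].
      apply is_cderive_ext with (1 := E1).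
      apply (is_cderive_mult (fun z => dg (L z)) dL); [|apply HdL].
      apply is_cderive_comp; [apply Hdg|apply HL]. }
    set (kap := fun w => ddg w / dg w).
    assert (Hkap : exists dkap, is_derivative kap dkap).
    { eexists. intros w. apply is_cderive_div; [apply Hddg|apply Hdg|apply Ng]. }
    destruct Hkap as [dkap Hkap].
    assert (E3 : forall z, kap (L z) * dL z + ddL z / dL z = dp z).
    { intros z. unfold kap.
      assert (N1 := Ng (L z)). assert (N2 := NL z).
      transitivity ((ddg (L z) * dL z * dL z + dg (L z) * ddL z) / (dg (L z) * dL z)).
      - field. auto.
      - rewrite E2, E1. field. apply HH. }
    (* [dp] is bounded with exponent [length p]; the factor z in z p'(z) adds one. *)
    set (d := S (length p)).
    (* The exponent d + 1 is the one at which [log_derivative_vanishes] asks polynomial growth to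
       fail. *)
    destruct (classic (exists B : R, (0 < B)%R /\ forall z, (Cmod (L z) <= B * (1 + Cmod z) ^ S d)%R))
      as [[B [HB HLB]]|Hgrow].
    + apply AL. exact (elh_polynomial_growth L dL B (S d) HL NL L1 HB HLB).
    + apply Ag. apply (elh_second_derivative_zero g dg Hg g1). intros w0.
      eapply is_cderive_eq; [apply Hdg|].
      assert (Hk : kap (0 + w0) = 0).
      { apply (log_derivative_vanishes (fun z => L z - w0) dL ddL (fun w => kap (w + w0))
          (fun w => dkap (w + w0)) dp d A); auto.
        - intros z. eapply is_cderive_eq; [apply is_cderive_minus; [apply HL|apply is_cderive_const]|].
          ring.
        - intros w. eapply is_cderive_eq.
          + apply (is_cderive_comp kap (fun w => w + w0)); [apply Hkap|].
            apply is_cderive_plus; [apply is_cderive_id|apply is_cderive_const].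
          + ring.
        - intros z. replace (L z - w0 + w0) with (L z) by ring. apply E3.
        - unfold d; lia.
        - intros z. rewrite Cmod_mult. destruct (HAB z) as [_ X]. unfold d. simpl.
          assert (Z := Cmod_ge_0 z). assert (Y := Cmod_ge_0 (dp z)).
          set (q := ((1 + Cmod z) ^ length p)%R) in *.
          replace (A * ((1 + Cmod z) * q))%R with ((1 + Cmod z) * (A * q))%R by ring.
          apply Rmult_le_compat; lra.
        (* Unbounded growth survives the shift: a bound B (1 + |z|)^(d+1) for |L - w0| would give
           the bound with B + |w0| for |L|. *)
        - intros B HB. apply NNPP. intros HN. apply Hgrow.
          assert (W := Cmod_ge_0 w0).
          exists (B + Cmod w0)%R. split; [lra|]. intros z.
          apply Rnot_lt_le. intros Hlt. apply HN. exists z.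
          assert (P1 : (1 <= (1 + Cmod z) ^ S d)%R)
            by (apply pow_R1_Rle; assert (Z := Cmod_ge_0 z); lra).
          assert (T := Cmod_triangle (L z - w0) w0).
          replace (L z - w0 + w0) with (L z) in T by ring. nra. }
      rewrite Cplus_0_l in Hk.
      transitivity (kap w0 * dg w0); [unfold kap; field; apply Ng|]. rewrite Hk. ring.
Qed.
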